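(* Let $X=GI(n;J)$ be a connected $GI$-graph. Then $X$ is a Cayley graph if and only if one of the following holds: (a) $J$ is primitive, and $J\cup -J$ is a multiplicative subgroup of $\mathbb{Z}_n^{*}$, with a subgroup of index $2$ that does not contain $-1$; or (b) $X=GI(n;J)$ is isomorphic to $GI(n;[k_0]J_0)$ for some primitive subset $J_0$ of $\mathbb{Z}_n$ and some integer $k_0>1$, such that either $GI(n;J_0)$ is a Cayley graph, or $k_0$ is even and $GI(n;J_0)$ is vertex-transitive but is not the dodecahedral graph $GI(10;1,2)$.
   Context: For positive integers $n\ge 3$ and $t$, and a sequence (or multiset) $J=\{j_0,\dots,j_{t-1}\}$ of integers with $0<j_k<n$ and $j_k\neq n/2$ (viewed mod $n$), the $GI$-graph $GI(n;J)=GI(n;j_0,\dots,j_{t-1})$ is the graph with vertex set $\mathbb{Z}_t\times\mathbb{Z}_n$ and two types of edges: an edge joining $(s,v)$ to $(s',v)$ for all distinct $s,s'\in\mathbb{Z}_t$ and all $v\in\mathbb{Z}_n$; and edges joining $(s,v)$ to $(s,v+j_s)$ and $(s,v-j_s)$ for all $s\in\mathbb{Z}_t$ and all $v\in\mathbb{Z}_n$. $[k]J$ denotes the concatenation of $k$ copies of the multiset $J$. A subset $J=\{j_0,\dots,j_{t-1}\}$ of $\mathbb{Z}_n$ is called primitive if $1\in J$ and $j_i\neq\pm j_k$ whenever $i\neq k$ (so a multiset with repeated elements is not primitive). $-J$ denotes $\{-j : j\in J\}$, and $\mathbb{Z}_n^{*}$ is the multiplicative group of units mod $n$. A graph is vertex-transitive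 if its automorphism group acts transitively on its vertices, and is a Cayley graph if its automorphism group has a subgroup acting regularly on its vertices.
   Formalization: Condition (a) is required of uJ for some unit u mod n, not of J itself (the same when 1 is in J); as written the claim fails, e.g. GI(5;2) is a 5-cycle, hence Cayley, but 1 is not in J and (b) is impossible. *)

(* Defs.v *)
From HB Require Import structures.
From mathcomp Require Import all_boot all_order all_algebra all_fingroup.

Set Implicit Arguments.
Unset Strict Implicit.
Unset Printing Implicit Defensive.

Import GRing.Theory.
Local Open Scope ring_scope.

(* Plain MathComp.  A finite graph is an adjacency relation [e : rel T] on a  *)
(* finite type; the relations used below are symmetric and irreflexive.       *)

Section Graphs.
Variable T : finType.
Implicit Type e : rel T.

Definition graph_connected e := forall x y : T, connect e x y.

Definition graph_aut e : {set {perm T}} :=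
  [set f : {perm T} | [forall x, forall y, e (f x) (f y) == e x y]].

Lemma graph_autP e (f : {perm T}) :
  reflect (forall x y, e (f x) (f y) = e x y) (f \in graph_aut e).
Proof.
rewrite inE; apply: (iffP forallP) => [H x y|H x].
  by have /forallP/(_ y)/eqP := H x.
by apply/forallP => y; rewrite H.
Qed.

Lemma graph_aut_group_set e : group_set (graph_aut e).
Proof.
apply/group_setP; split=> [|f g /graph_autP Hf /graph_autP Hg].
  by apply/graph_autP => x y; rewrite !perm1.
by apply/graph_autP => x y; rewrite !permM Hg Hf.
Qed.

Canonical graph_aut_group e := Group (graph_aut_group_set e).

Definition vertex_transitive e :=
  [transitive graph_aut e, on [set: T] | 'P].

Definition acts_regularly (G : {group {perm T}}) :=
  [transitive G, on [set: T] | 'P] /\ (forall x : T, ('C_G[x | 'P] = 1)%g).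

Definition is_cayley e :=
  exists G : {group {perm T}}, G \subset graph_aut e /\ acts_regularly G.

End Graphs.

Definition graph_iso (T1 T2 : finType) (e1 : rel T1) (e2 : rel T2) :=
  exists2 f : T1 -> T2, bijective f & forall x y, e2 (f x) (f y) = e1 x y.

(* The parameters j_0, ..., j_(t-1) are a sequence of residues, t being its   *)
(* length.  An element of 'Z_n is its representative in {0, ..., n - 1};      *)
(* everything below is meant for n > 2.                                       *)

Section GIGraphs.
Variable n : nat.
Implicit Type J : seq 'Z_n.

Definition GI_params J : Prop :=
  (0 < size J)%N /\
  forall j : 'Z_n, j \in J -> (0 < val j)%N /\ (val j).*2 <> n.

Definition GI J : rel ('I_(size J) * 'Z_n) :=
  fun x y =>
    ((x.1 != y.1) && (x.2 == y.2))
    || ((x.1 == y.1) && ((y.2 == x.2 + J`_(x.1)) || (y.2 == x.2 - J`_(x.1)))).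
Arguments GI J x y : clear implicits.

Definition repeat_params (k : nat) J : seq 'Z_n := flatten (nseq k J).

Definition primitive J : Prop :=
  1 \in J /\
  forall i k : 'I_(size J), i != k -> J`_i <> J`_k /\ J`_i <> - J`_k.

Definition pm_set J : {set 'Z_n} :=
  [set j in J] :|: [set - j | j in J].

Definition unit_vals (A : {set {unit 'Z_n}}) : {set 'Z_n} :=
  [set val u | u in A].

Definition primitive_subgroup J : Prop :=
  primitive J /\
  exists A : {group {unit 'Z_n}},
    pm_set J = unit_vals A /\
    exists B : {group {unit 'Z_n}},
      [/\ B \subset A, #|A : B|%g = 2%N & -1 \notin unit_vals B].

Definition scale_params (u : {unit 'Z_n}) J : seq 'Z_n :=
  [seq val u * j | j <- J].

Lemma GI_sym J : symmetric (GI J).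
Proof.
have key (v w j : 'Z_n) : (w == v + j) = (v == w - j).
  by rewrite [RHS]eq_sym subr_eq.
move=> x y; rewrite /GI [y.1 == _]eq_sym [y.2 == x.2]eq_sym.
have [->|//] := eqVneq x.1 y.1.
by rewrite (key x.2 y.2 J`_y.1) (key y.2 x.2 J`_y.1) /= orbC.
Qed.

Lemma GI_irr J : GI_params J -> irreflexive (GI J).
Proof.
case=> _ HJ x; rewrite /GI !eqxx /= -{1 3}[x.2]addr0.
rewrite !(inj_eq (addrI _)) [0 == - _]eq_sym oppr_eq0 eq_sym orbb.
have [j0 _] := HJ _ (mem_nth 0 (ltn_ord x.1)).
by apply/eqP => j00; rewrite j00 in j0.
Qed.

(* Multiplication by a unit does not change the isomorphism class of a        *)
(* GI-graph, so the condition [1 \in J] in [primitive] is a normalisation; it *)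
(* has to be read up to such a multiplication when it is imposed on the       *)
(* parameters of a given graph: GI(5; 2) is a 5-cycle, just as GI(5; 1).      *)
(* For parameters that already contain 1 nothing changes.                     *)

Lemma GI_scale_iso (u : {unit 'Z_n}) J :
  graph_iso (GI J) (GI (scale_params u J)).
Proof.
have Es : size J = size (scale_params u J) by rewrite size_map.
have uu : val u \is a GRing.unit by exact: (valP u).
exists (fun x => (cast_ord Es x.1, val u * x.2)).
  exists (fun x => (cast_ord (esym Es) x.1, (val u)^-1 * x.2)) => -[i v] /=.
    by rewrite cast_ordK mulKr.
  by rewrite cast_ordKV mulVKr.
move=> [i v] [k w]; rewrite /GI /=.
have -> : (scale_params u J)`_i = val u * J`_i by rewrite (nth_map 0).
by rewrite -mulrBr -mulrDr !(inj_eq (mulrI uu)) (inj_eq (@cast_ord_inj _ _ _)).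
Qed.

Lemma primitive_subgroup_scale J : 1 \in J ->
  (exists u : {unit 'Z_n}, primitive_subgroup (scale_params u J))
    <-> primitive_subgroup J.
Proof.
have scale1 K : scale_params 1%g K = K.
  by rewrite /scale_params -[RHS]map_id; apply: eq_map => j; rewrite mul1r.
move=> J1; split=> [[u [[_ prJ] [A [EA HB]]]]|H]; last first.
  by exists 1%g; rewrite scale1.
have uu : val u \is a GRing.unit by exact: (valP u).
have Es : size (scale_params u J) = size J by rewrite size_map.
have uA : u \in A.
  have: val u \in pm_set (scale_params u J).
    have: val u * 1 \in scale_params u J by exact: map_f J1.
    by rewrite mulr1 !inE => ->.
  by rewrite EA => /imsetP[a aA /val_inj->].
have EJ : pm_set J = unit_vals A.
  have memS K x : (x \in pm_set K) = (x \in K) || (- x \in K).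
    rewrite !inE; congr (_ || _); apply/imsetP/idP => [[y yK ->]|xK].
      by rewrite opprK.
    by exists (- x); rewrite ?opprK.
  have memU x : (x \in pm_set J) = (val u * x \in pm_set (scale_params u J)).
    by rewrite !memS -mulrN !(mem_map (mulrI uu)).
  apply/setP => x; rewrite memU EA; apply/imsetP/imsetP => -[a aA Ea].
    exists (u^-1 * a)%g; first by rewrite groupM ?groupV.
    by rewrite /= -Ea mulKr.
  by exists (u * a)%g; rewrite ?groupM //= Ea.
split; last by exists A.
split=> // i k ik.
have nthS (l : 'I_(size J)) : (scale_params u J)`_l = val u * J`_l.
  by rewrite (nth_map 0).
have := prJ (cast_ord (esym Es) i) (cast_ord (esym Es) k).
rewrite (inj_eq (@cast_ord_inj _ _ _)) => /(_ ik); rewrite /= !nthS => -[H1 H2].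
by split=> E; [apply: H1 | apply: H2]; rewrite E ?mulrN.
Qed.

End GIGraphs.

Arguments GI {n} J x y.

Definition dodecahedral_graph := @GI 10 [:: 1; 2].

(* Main.v *)
(* Up to a unit and signs, both alternatives say that [J] consists of [m]     *)
(* copies of a subgroup [C] of the units; then the affine maps v |-> c v + b  *)
(* with c in [C], together with a cyclic permutation of the copies, act       *)
(* regularly.  Conversely, suppose that a vertex-transitive group of          *)
(* automorphisms permutes the spokes.  Then layers go to layers, all          *)
(* parameters are units, and every automorphism is affine: its multipliers    *)
(* stabilise the multiset [J] up to sign, so that [J] is [m] copies of a      *)
(* group containing -1, taken modulo signs.  If the action is regular and [m] *)
(* is odd, no automorphism fixing a spoke has multiplier -1, since a suitable *)
(* odd power of it would be a 2-element permuting the m layers +-j, hence fix *)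
(* a vertex; the multipliers at a spoke then form the subgroup sought.        *)
(*   Automorphisms preserve spokes when there are at least four layers, and   *)
(* for three layers unless n = 3, as spokes then lie in more triangles than   *)
(* layer edges.  For two layers [j], [k], an arc is characterised by the      *)
(* numbers of closed reduced walks of length 8 and 10 that start with it;     *)
(* these walks correspond to words whose displacement (a, b) satisfies        *)
(* a j + b k = 0.  If some spoke goes to a layer edge, all these numbers      *)
(* agree, which forces two independent short relations, hence n <= 26.  The   *)
(* finitely many solutions either satisfy j^2 = k^2 or are the Petersen,      *)
(* Desargues and dodecahedral graphs, which are not Cayley: a cubic Cayley    *)
(* graph without 3- and 4-cycles has an edge in no 5-cycle.                   *)

Require Import Defs.
From mathcomp Require Import all_boot all_order all_algebra all_fingroup.
From mathcomp Require Import cyclic pgroup sylow zify.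

Set Implicit Arguments.
Unset Strict Implicit.
Unset Printing Implicit Defensive.

Import GRing.Theory.
Local Open Scope ring_scope.

(** The pivot is the arithmetic condition [cayley_params]: after scaling by a unit, and up to signs,
    [J] consists of [m] copies of a subgroup [C] of the units. For spanning parameters it is
    equivalent to being Cayley, and the two alternatives rewrite it.

    From parameters to graphs ([cayley_params_cayley]), [labelled_cayley] names each layer by a copy
    and an element of [C], and builds a regular group from the translations of these labels and the
    affine maps of the residues.

    From graphs to parameters ([cayley_params_of_cayley]), the question is whether automorphisms
    permute the spokes. By [vertex_transitive_cases] they do, or the parameters already have the
    required form, or the graph is one of three exceptions. [cayley_girth5] shows that the Petersen
    and dodecahedral graphs are not Cayley, and disposes of the Desargues graph through its
    distance-4 graph. When spokes are preserved, [respecting_affine] makes automorphisms affine, and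
    [J] is [m] copies of a group [C] containing -1, taken modulo signs ([transitive_params]). For
    even [m] the copies pair up; for odd [m] a regular group yields a subgroup [B] without -1 such
    that [C] is the union of [B] and [- B] ([regular_odd_params]).

    In [cayley_params_alternatives], -1 in [C] gives (b) with [k0] even; otherwise [m = 1] gives (a)
    and [m > 1] gives (b). Conversely, (a) supplies [C] as the subgroup of index 2, and (b) follows
    from [repeat_cayley_params] or [repeat_transitive_params]. For the latter,
    [vertex_transitive_params] has to exclude only the dodecahedral graph, as the parameters of the
    other two exceptions represent all units modulo signs. *)

(** * Regular actions and their transport along isomorphisms *)

Section CayleyGraphs.
Variable T : finType.
Implicit Types (e : rel T) (g : {perm T}).

Lemma transitiveP (G : {group {perm T}}) (x0 : T) :
  reflect (forall x y, exists2 g, g \in G & g x = y)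
          [transitive G, on [set: T] | 'P].
Proof.
apply: (iffP idP) => [tr x y | tr].
  have /orbitP[g Gg <-] : y \in orbit 'P G x.
    by rewrite (atransP tr) ?inE.
  by exists g.
apply/imsetP; exists x0 => //; apply/setP => y; rewrite inE; symmetry.
by have [g gG <-] := tr x0 y; apply/orbitP; exists g.
Qed.

Definition cayley_action e (G : {set {perm T}}) :=
  [/\ forall g, g \in G -> forall x y, e (g x) (g y) = e x y,
      forall x y, exists2 g, g \in G & g x = y &
      forall g x, g \in G -> g x = x -> g = 1%g].

Lemma cayley_intro e (G : {set {perm T}}) (x0 : T) :
  1%g \in G -> {in G &, forall g h, (g * h)%g \in G} -> cayley_action e G ->
  is_cayley e.
Proof.
move=> G1 GM [Ge Gtr Gfree].
have gG : group_set G by apply/group_setP.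
exists (Group gG); split.
  by apply/subsetP => g gG'; apply/graph_autP; apply: Ge.
split=> [|x]; first exact/(transitiveP _ x0).
apply/trivgP/subsetP => g /setIP[gG' /astab1P gx].
by rewrite inE (Gfree _ x gG').
Qed.

Lemma cayley_elim e (x0 : T) : is_cayley e ->
  exists G : {group {perm T}}, cayley_action e G.
Proof.
case=> G [/subsetP Ge [tr fr]]; exists G; split.
- by move=> g /Ge /graph_autP.
- exact/transitiveP.
- move=> g x gG gx; apply/eqP; rewrite -in_set1 -[[set 1%g]](fr x).
  by rewrite inE gG; apply/astab1P.
Qed.

End CayleyGraphs.

Section GraphIso.
Variables T1 T2 : finType.

Lemma graph_iso_sym (e1 : rel T1) (e2 : rel T2) :
  graph_iso e1 e2 -> graph_iso e2 e1.
Proof.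
case=> f [f' fK f'K] fe; exists f'; first by exists f.
by move=> x y; rewrite -fe !f'K.
Qed.

Lemma graph_iso_trans (T3 : finType) (e1 : rel T1) (e2 : rel T2) (e3 : rel T3) :
  graph_iso e1 e2 -> graph_iso e2 e3 -> graph_iso e1 e3.
Proof.
case=> f fb fe [g gb ge]; exists (g \o f); first exact: bij_comp.
by move=> x y; rewrite /= ge fe.
Qed.

(** Conjugation by the isomorphism carries a regular group to a regular group. *)
Lemma graph_iso_cayley (e1 : rel T1) (e2 : rel T2) (x0 : T1) :
  graph_iso e1 e2 -> is_cayley e1 -> is_cayley e2.
Proof.
case=> f [f' fK f'K] fe /(cayley_elim x0)[G [Ge Gtr Gfree]].
pose c (g : {perm T2}) := perm (can_inj (can_comp (can_comp f'K (permK g)) fK)).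
have cE g x : c g x = f' (g (f x)) by rewrite permE.
have cV (h : {perm T1}) : exists g, c g = h /\ forall x, g x = f (h (f' x)).
  have inj : injective (fun x => f (h (f' x))).
    by move=> x y /(can_inj fK) /perm_inj /(can_inj f'K).
  exists (perm inj); split=> [|x]; last by rewrite permE.
  by apply/permP => x; rewrite cE permE !fK.
apply: (@cayley_intro _ _ [set g | c g \in G] (f x0)) => [||].
- rewrite inE; suff -> : c 1%g = 1%g by rewrite group1.
  by apply/permP => x; rewrite cE !perm1 fK.
- move=> g h; rewrite !inE => gG hG.
  suff -> : c (g * h)%g = (c g * c h)%g by rewrite groupM.
  by apply/permP => x; rewrite permM !cE permM f'K.
split.
- move=> g; rewrite inE => /Ge H x y.
  by have := H (f' x) (f' y); rewrite !cE !f'K -!fe !f'K.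
- move=> x y; have [h hG hxy] := Gtr (f' x) (f' y).
  have [g [gh gE]] := cV h; exists g; first by rewrite inE gh.
  by rewrite gE hxy f'K.
- move=> g x; rewrite inE => gG gx.
  have c1 : c g = 1%g by apply: (Gfree _ (f' x) gG); rewrite cE f'K gx.
  apply/permP => y; rewrite perm1.
  by apply: (can_inj f'K); have := cE g (f' y); rewrite c1 perm1 f'K.
Qed.

End GraphIso.

(** * Cubic Cayley graphs without 3- and 4-cycles *)

(* In a Cayley graph closed walks are relators in the connection set [D].     *)
Section NoGirthFive.
Variables (gT : finGroupType) (D : {set gT}).
Hypothesis D_V : forall d, d \in D -> (d^-1)%g \in D.
Hypothesis D_card : #|D| = 3%N.
Hypothesis D_C3 : forall x y, x \in D -> y \in D -> (x * y)%g \notin D.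
Hypothesis D_C4 : forall x y z w, x \in D -> y \in D -> z \in D -> w \in D ->
  (x * y * z * w = 1 -> x * y = 1 \/ y * z = 1)%g.
Hypothesis D_C5 : forall a, a \in D -> exists b c d f,
  [/\ b \in D, c \in D, d \in D, f \in D & (a * b * c * d * f = 1)%g].

Local Open Scope group_scope.

Let comm_eq x y : x \in D -> y \in D -> x * y = y * x -> x = y \/ x * y = 1.
Proof.
move=> xD yD xy.
have E : x * y * x^-1 * y^-1 = 1.
  by rewrite xy -(mulgA y) mulgV mulg1 mulgV.
case: (D_C4 xD yD (D_V xD) (D_V yD) E) => [|/eqP]; first by right.
by rewrite -eq_mulgV1 eq_sym => /eqP; left.
Qed.

Let rot1 x y : x * y = 1 -> y * x = 1 :> gT.
Proof. by move=> xy; apply: (mulgI x); rewrite mulgA xy mul1g mulg1. Qed.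

Let rot5 a b c d f : a * b * c * d * f = 1 -> b * c * d * f * a = 1 :> gT.
Proof. by move=> E; apply: rot1; rewrite !mulgA. Qed.

Let no_C3 x y z : x \in D -> y \in D -> z \in D -> x * y * z <> 1.
Proof.
move=> xD yD zD /(canRL (mulgK z)) E.
by have := D_C3 xD yD; rewrite E mul1g D_V.
Qed.

(** A proper 3-colouring of a 5-cycle uses one colour once, so this is, up to rotation and renaming,
    the only reduced relator of length 5 in three involutions. Inverting it gives [z = xyxy = yxyx];
    then [z] commutes with [x], which forces [z = x] and a 3-cycle. *)
Let no_xyxyz x y z : x \in D -> y \in D -> z \in D ->
  x * x = 1 -> y * y = 1 -> z * z = 1 -> x * y * x * y * z = 1 -> False.
Proof.
move=> xD yD zD xx yy zz E.
have zE : z = x * y * x * y.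
  by rewrite -[LHS]mul1g -E -!mulgA zz mulg1.
have zE' : z = y * x * y * x.
  apply: (mulgI z); rewrite zz {1}zE -!mulgA (mulgA y y) yy mul1g.
  by rewrite (mulgA x x) xx mul1g (mulgA y y) yy mul1g xx.
have zx : z * x = x * z.
  by rewrite {1}zE' zE -!mulgA xx mulg1 !mulgA xx mul1g.
have {zx} zx : z = x.
  case: (comm_eq zD xD zx) => // E1.
  by rewrite -[z]mulg1 -xx mulgA E1 mul1g.
apply: (no_C3 yD xD yD).
have -> : y * x * y = x * (x * y * x * y * x) * x.
  by rewrite -!mulgA xx mulg1 (mulgA x x) xx mul1g.
by rewrite -{4}zx E mulg1.
Qed.

(** Conjugation by the involution [a] sends [c ^ 2] to [w^-1]; squaring this and conjugating back
    gives [c ^ 4 = c], hence a 3-cycle. *)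
Let no_accaw a c w : a \in D -> c \in D -> a * a = 1 -> c * c <> 1 ->
  w = c \/ w = c^-1 -> a * c * c * a * w = 1 -> False.
Proof.
move=> aD cD aa cc wc E.
suff c3 : c * c * c = 1 by apply: no_C3 c3.
have E1 : a * (c * c) * a = w^-1.
  by apply: (mulIg w); rewrite mulVg -E !mulgA.
have sq : a * (c * c * (c * c)) * a = w^-1 * w^-1.
  by rewrite -!E1 -!mulgA (mulgA a a) aa mul1g.
have E2 : a * (w^-1 * w^-1) * a = c * c * (c * c).
  by rewrite -sq !mulgA aa mul1g -!mulgA aa mulg1.
have aV : a^-1 = a by apply: (mulgI a); rewrite aa mulgV.
apply: (mulIg c); rewrite mul1g -[LHS]mulgA -E2.
case: wc => wE; last by rewrite wE !invgK !mulgA -(mulgA a) E1 wE invgK.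
transitivity (w^-1)^-1; last by rewrite invgK.
by rewrite -[in RHS]E1 !invMg aV wE !mulgA.
Qed.

Let no_square a b c d f : a \in D -> b \in D -> c \in D -> d \in D ->
  f \in D -> a * b * c * d * f = 1 ->
  [/\ a * b <> 1, b * c <> 1, c * d <> 1, d * f <> 1 & f * a <> 1].
Proof.
move=> aD bD cD dD fD E.
split=> ab.
- by apply: (no_C3 cD dD fD); rewrite -E ab mul1g.
- by apply: (no_C3 aD dD fD); rewrite -E -(mulgA a b) ab mulg1.
- by apply: (no_C3 aD bD fD); rewrite -E -(mulgA (a * b) c) ab mulg1.
- by apply: (no_C3 aD bD cD); rewrite -E -(mulgA (a * b * c) d) ab mulg1.
- by apply: (no_C3 bD cD dD); rewrite -(rot1 E) !mulgA ab mul1g.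
Qed.

(** Either [D] consists of three involutions, or of one involution [a] and a pair [b], [b^-1]. The
    reduced relators of length 5 are rotations of [xyxyz] in the first case; those through [a] are
    [accaw], up to rotation, and [a b ^ 4] in the second. The last one makes [a] commute with
    [b]. *)
Lemma no_girth5_connection_set : False.
Proof.
have [a0 a0D] : exists a, a \in D by apply/card_gt0P; rewrite D_card.
have third a b : a \in D -> b \in D -> a != b ->
    exists2 c, [/\ c \in D, c != a & c != b] &
    forall x, x \in D -> [\/ x = a, x = b | x = c].
  move=> aD bD ab; have /eqP/cards1P[c E] : #|D :\ a :\ b| = 1%N.
    move: (cardsD1 a D) (cardsD1 b (D :\ a)).
    by rewrite aD D_card !inE eq_sym ab bD /= !add1n => -[<-] [].
  exists c.
    by have := set11 c; rewrite -E !inE => /and3P[].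
  move=> x xD; have [->|xa] := eqVneq x a; first by constructor 1.
  have [->|xb] := eqVneq x b; first by constructor 2.
  by constructor 3; apply/set1P; rewrite -E !inE xa xb.
have [inv|] := boolP [forall x in D, x * x == 1].
  have {}inv x : x \in D -> x * x = 1 by move/(forall_inP inv)/eqP.
  have [b [c [d [f [bD cD dD fD E]]]]] := D_C5 a0D; rename a0D into aD.
  have [ab bc cd df fa] := no_square aD bD cD dD fD E.
  have a0b : a0 != b by apply/eqP => abE; apply: ab; rewrite -abE inv.
  have [e [eD _ _] De] := third _ _ aD bD a0b.
  have neq (P : Prop) x y : x \in D -> x * y <> 1 -> x = y -> P.
    by move=> xD xy xyE; case: xy; rewrite -xyE inv.
  have [aa bb ee] : [/\ a0 * a0 = 1, b * b = 1 & e * e = 1] by rewrite !inv.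
  case: (De c) => // cE; [|exact: neq bc _|]; subst c.
    case: (De d) => // dE; [exact: neq cd _| |]; subst d.
      case: (De f) => // fE; [exact: neq fa _|exact: neq df _|]; subst f.
      exact: no_xyxyz E.
    case: (De f) => // fE; [exact: neq fa _| |exact: neq df _]; subst f.
    by apply: (no_xyxyz bD aD eD) => //; do 4 apply: rot5.
  case: (De d) => // dE; [| |exact: neq cd _]; subst d.
    case: (De f) => // fE; [exact: neq fa _| |]; subst f.
      by apply: (no_xyxyz aD bD eD) => //; do 3 apply: rot5.
    by apply: (no_xyxyz eD aD bD) => //; do 2 apply: rot5.
  case: (De f) => // fE; [exact: neq fa _|exact: neq df _|]; subst f.
  by apply: (no_xyxyz bD eD aD) => //; apply: rot5.
rewrite negb_forall_in => /exists_inP[b0 b0D /eqP bb0].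
have nV (x : gT) : x * x <> 1 -> x != x^-1.
  by move=> xx; apply/eqP => xE; case: xx; rewrite {2}xE mulgV.
have [a [aD ab aV] Da] := third _ _ b0D (D_V b0D) (nV _ bb0).
have aa : a * a = 1.
  case: (Da _ (D_V aD)) => E; last by rewrite -{1}E mulVg.
    by rewrite -E invgK eqxx in aV.
  by rewrite (invg_inj E) eqxx in ab.
have Dp p : p \in D -> p != a ->
    p * p <> 1 /\ forall x, x \in D -> [\/ x = p, x = p^-1 | x = a].
  move=> pD pa; case: (Da p pD) => E; subst p; last by rewrite eqxx in pa.
    by split.
  split=> [/(congr1 invg)|x /Da[]->]; first by rewrite invMg invgK invg1.
  - by constructor 2; rewrite invgK.
  - by constructor 1.
  - by constructor 3.
have [b [c [d [f [bD cD dD fD E]]]]] := D_C5 aD.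
have [ab1 bc cd df fa] := no_square aD bD cD dD fD E.
have neqa (x : gT) : x * a <> 1 -> x != a.
  by move=> H; apply/eqP => xE; rewrite xE in H.
have ba : b != a by apply: neqa => /rot1.
have {neqa} fa' : f != a by apply: neqa.
have [bb Db] := Dp _ bD ba.
case: (Db _ cD) => cE; subst c; last 1 first.
- have da : d != a by apply: contra_not_neq cd => ->.
  have [dd Dd] := Dp _ dD da.
  have fd : f = d.
    case: (Dd _ fD) => // fE; last by rewrite fE eqxx in fa'.
    by rewrite fE mulgV in df.
  subst f; apply: (no_accaw aD dD aa dd (w := b)).
    by case: (Dd _ bD); [left | right | move=> bE; rewrite bE eqxx in ba].
  by do 2 apply: rot5.
- case: (Db _ dD) => dE; subst d; last 1 first.
  + apply: (no_accaw aD bD aa bb _ E).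
    by case: (Db _ fD); [left | right | move=> fE; rewrite fE eqxx in fa'].
  + have fb : f = b.
      case: (Db _ fD) => // fE; last by rewrite fE eqxx in fa'.
      by rewrite fE mulgV in df.
    subst f; have aE : a = (b * b * b * b)^-1.
      by apply: (mulIg (b * b * b * b)); rewrite mulVg -E !mulgA.
    have abC : a * b = b * a.
      rewrite aE; apply: (mulgI (b * b * b * b)); rewrite mulgA mulgV mul1g.
      rewrite [RHS]mulgA -[LHS](mulgK (b * b * b * b)).
      by congr (_ * _); rewrite !mulgA.
    by case: (comm_eq aD bD abC) => // abE; rewrite abE eqxx in ba.
  + by rewrite mulgV in cd.
- by rewrite mulgV in bc.
Qed.

End NoGirthFive.

(** A vertex is identified with the element of [G] that carries [x0] to it, so that [D] is the
    neighbourhood of [x0]. As the left factor of a product acts first, a word is walked from [x0]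
    through its suffixes. *)
Lemma cayley_girth5 (T : finType) (e : rel T) (G : {group {perm T}}) (x0 : T) :
  symmetric e -> cayley_action e G -> #|[pred y | e x0 y]| = 3%N ->
  (forall x y z, e x y -> e y z -> ~~ e x z) ->
  (forall x y z w, e x y -> e y z -> e z w -> e w x -> x = z \/ y = w) ->
  (forall x y, e x y -> exists z w u, [/\ e y z, e z w, e w u & e u x]) ->
  False.
Proof.
move=> e_sym [Ge Gtr Gfree] card3 C3 C4 C5.
pose D := [set g in G | e x0 (g x0)].
have DP g : reflect (g \in G /\ e x0 (g x0)) (g \in D).
  by rewrite inE; apply: andP.
have Ginj g h : g \in G -> h \in G -> g x0 = h x0 -> g = h.
  move=> gG hG gh; apply/eqP; rewrite eq_mulgV1; apply/eqP.
  by apply: (Gfree _ x0); rewrite ?groupM ?groupV // permM gh permK.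
have De g h : g \in D -> h \in G -> e (h x0) ((g * h)%g x0).
  by case/DP=> gG gx hG; rewrite permM Ge.
apply: (@no_girth5_connection_set _ D).
- move=> g /DP[gG gx]; apply/DP; rewrite groupV gG; split=> //.
  by rewrite -(Ge _ gG) permKV e_sym.
- rewrite -card3 -(@card_in_imset _ _ (fun g : {perm T} => g x0) D).
    apply: eq_card => y; rewrite inE; apply/imsetP/idP => [[g /DP[_ gx] ->] //|].
    by move=> xy; have [g gG gx] := Gtr x0 y; exists g => //; apply/DP; rewrite gx.
  by move=> g h /DP[gG _] /DP[hG _]; apply: Ginj.
- move=> g h gD hD; apply/DP => -[_].
  apply/negP; have [hG hx] := DP _ hD.
  exact: C3 hx (De _ _ gD hG).
- move=> x y z w xD yD zD wD E.
  have [[xG _] [yG _] [zG _] [wG wx]] :=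
    And4 (DP _ xD) (DP _ yD) (DP _ zD) (DP _ wD).
  have zwG : (z * w)%g \in G by rewrite groupM.
  have yzwG : (y * (z * w))%g \in G by rewrite groupM.
  have p4 : e ((y * (z * w))%g x0) x0.
    by have := De _ _ xD yzwG; rewrite !mulgA E perm1.
  case: (C4 _ _ _ _ wx (De _ _ zD wG) (De _ _ yD zwG) p4) => H.
    left; have zw : (z * w = 1)%g by apply: (Gfree _ x0).
    by move: E; rewrite -mulgA zw mulg1.
  right; have/esym := Ginj _ _ wG yzwG H; rewrite mulgA => /(canRL (mulgK w)).
  by rewrite mulgV.
- move=> a aD; have [aG ax] := DP _ aD.
  have [p2 [p3 [p4 [e12 e23 e34 e40]]]] := C5 _ _ ax.
  have [[g2 G2 E2] [g3 G3 E3] [g4 G4 E4]] :=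
    And3 (Gtr x0 p2) (Gtr x0 p3) (Gtr x0 p4).
  have Dstep g h : g \in G -> h \in G -> e (g x0) (h x0) -> (h * g^-1)%g \in D.
    move=> gG hG gh; apply/DP; rewrite groupM ?groupV //; split=> //.
    by rewrite permM -(Ge _ gG) permKV.
  exists (g4^-1)%g, (g4 * g3^-1)%g, (g3 * g2^-1)%g, (g2 * a^-1)%g; split.
  - by rewrite -[(g4^-1)%g]mul1g Dstep // perm1 E4.
  - by rewrite Dstep ?E3 ?E4.
  - by rewrite Dstep ?E3 ?E2.
  - by rewrite Dstep ?E2.
  by rewrite !mulgA !(mulgKV, mulgK) mulgV.
Qed.

(** * Residues modulo [n] and connectedness *)

Section Residues.
Variables (n : nat) (hn : (2 < n)%N).
Implicit Types (J K : seq 'Z_n) (x j : 'Z_n).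

Let n1 : (1 < n)%N := ltnW hn.

Lemma Zn_mulrn_eq0 x m : (x *+ m == 0) = (n %| val x * m)%N.
Proof.
by rewrite -[x in LHS]natr_Zp -mulrnA -val_eqE /= val_Zp_nat.
Qed.

Lemma Zn_natr_eq0 m : (m%:R == 0 :> 'Z_n) = (n %| m)%N.
Proof. by rewrite -val_eqE /= val_Zp_nat. Qed.

(** For [d = gcd(n, x)] the multiplier [n / d] kills [x], which forces [d = 1]. *)
Lemma Zn_unit x : (forall m, x *+ m = 0 -> (n %| m)%N) -> x \is a GRing.unit.
Proof.
move=> xm; rewrite -[x]natr_Zp unitZpE //.
set d := gcdn n x; have d0 : (0 < d)%N by rewrite gcdn_gt0 (ltn_trans _ n1).
have /dvdn_leq : (n %| n %/ d)%N.
  apply: xm; apply/eqP; rewrite Zn_mulrn_eq0 muln_divA ?dvdn_gcdl //.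
  by rewrite mulnC -muln_divA ?dvdn_mulr ?dvdn_gcdr.
have n0 : (0 < n)%N by apply: ltn_trans n1.
have dn : (d <= n)%N by apply: dvdn_leq (dvdn_gcdl _ _).
rewrite divn_gt0 // dn => /(_ isT) H.
rewrite /coprime -/d eqn_leq d0 andbT leqNgt; apply/negP => d1.
by move: H; rewrite leqNgt ltn_Pdiv.
Qed.

Lemma one_neqN1 : 1 != -1 :> 'Z_n.
Proof.
rewrite -subr_eq0 opprK -[1 + 1]/(2%:R) Zn_natr_eq0.
by apply: contraL hn => /dvdn_leq; rewrite -leqNgt; apply.
Qed.

Lemma params_double J j : GI_params J -> j \in J -> j *+ 2 != 0.
Proof.
case=> _ HJ /HJ [j0 j2]; rewrite Zn_mulrn_eq0 muln2.
have jn : (val j < n)%N by have := ltn_ord j; rewrite [X in (_ < X)%N]Zp_cast.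
apply/negP => /dvdnP[[|[|q]] E].
- by move: j0; rewrite -double_gt0 E.
- by rewrite mul1n in E.
have : ((val j).*2 < n.*2)%N by rewrite ltn_double.
by rewrite E -muln2 mulnC ltnNge leq_mul2l orbT.
Qed.

Lemma unit_double x : x \is a GRing.unit -> x *+ 2 != 0.
Proof.
move=> ux; rewrite -mulr_natr -[X in _ != X](mulr0 x) (inj_eq (mulrI ux)).
by rewrite Zn_natr_eq0; apply: contraL hn => /dvdn_leq; rewrite -leqNgt; apply.
Qed.

(** Amounts to [n] and the parameters having no common factor; in this form, a multiplier that kills
    all parameters bounds [n]. *)
Definition spans J := forall m, (forall j, j \in J -> j *+ m = 0) -> (n %| m)%N.

(** If [m] kills all parameters, then [m] times the residue is constant along edges; residues 0 and
    1 are compared. *)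
Lemma connected_spans J : GI_params J -> graph_connected (GI J) -> spans J.
Proof.
move=> [J0 _] Jc m Jm; rewrite -Zn_natr_eq0; apply/eqP.
have stepm (x y : 'I_(size J) * 'Z_n) : GI J x y -> y.2 *+ m = x.2 *+ m.
  case/orP=> [/andP[_ /eqP->] //|/andP[_]].
  have jm : J`_x.1 *+ m = 0 by apply: Jm; rewrite mem_nth.
  by case/orP=> /eqP->; rewrite ?mulrnBl ?mulrnDl jm ?subr0 ?addr0.
pose s0 := Ordinal J0.
have /connectP[p xp E] := Jc (s0, 0) (s0, 1).
have H (x : 'I_(size J) * 'Z_n) : path (GI J) x p -> (last x p).2 *+ m = x.2 *+ m.
  elim: p x {xp E} => //= y p IHp x /andP[xy /IHp->]; exact: stepm.
by have := H _ xp; rewrite -E /= mul0rn.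
Qed.

Lemma spans1 J : 1 \in J -> spans J.
Proof. by move=> J1 m /(_ _ J1)/eqP; rewrite Zn_natr_eq0. Qed.

End Residues.

(** * Multiplicities of parameters up to sign *)

Section Multiplicity.
Variables (n : nat) (hn : (2 < n)%N).
Implicit Types (J K : seq 'Z_n) (j : 'Z_n) (C : {group {unit 'Z_n}}).

(** A layer with parameter [j] is the same as one with [- j], so these multiplicities determine the
    graph up to isomorphism. *)
Definition pm_mult J (x : 'Z_n) := count [pred j | (j == x) || (j == - x)] J.

Lemma mem_unit_vals (A : {set {unit 'Z_n}}) (c : {unit 'Z_n}) :
  (val c \in unit_vals A) = (c \in A).
Proof. by rewrite mem_imset //; apply: val_inj. Qed.

Lemma unit_valsP (A : {set {unit 'Z_n}}) x :
  reflect (exists2 c, c \in A & x = val c) (x \in unit_vals A).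
Proof. exact: imsetP. Qed.

Lemma layers_iso J K (f : 'I_(size J) -> 'I_(size K)) :
  bijective f -> (forall i : 'I_(size J), J`_i = K`_(f i) \/ J`_i = - K`_(f i)) ->
  graph_iso (GI J) (GI K).
Proof.
move=> [f' fK f'K] JK; exists (fun x => (f x.1, x.2)).
  by exists (fun x => (f' x.1, x.2)) => -[i v] /=; rewrite ?fK ?f'K.
move=> [i v] [k w]; rewrite /GI /= (can_eq fK); congr (_ || _ && _).
by case: (JK i) => ->; rewrite ?opprK // orbC.
Qed.

(** Picks one of [x] and [- x], so that equality up to sign becomes equality. *)
Let norm (x : 'Z_n) := if (val x <= val (- x)%R)%N then x else - x.

Let normE x y : (norm x == norm y) = (x == y) || (x == - y).
Proof.
have normN z : norm (- z) = norm z.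
  rewrite /norm opprK; case: ltngtP => // /val_inj ->//.
have norm_or z : norm z = z \/ norm z = - z by rewrite /norm; case: ifP; auto.
apply/eqP/orP => [|[/eqP->|/eqP->] //].
have [nx|nx] := norm_or x; have [ny|ny] := norm_or y; rewrite nx ny => E.
- by left; rewrite E.
- by right; rewrite E.
- by right; rewrite -E opprK.
- by left; apply/eqP/oppr_inj.
Qed.

Lemma pm_mult_iso J K : pm_mult J =1 pm_mult K -> graph_iso (GI J) (GI K).
Proof.
move=> JK; have multE L x : pm_mult L x = count_mem (norm x) (map norm L).
  by rewrite count_map; apply: eq_count => j /=; rewrite normE.
have normK x : norm (norm x) = norm x.
  apply/eqP; rewrite normE /norm; case: ifP; by rewrite eqxx ?orbT.
have pJK : perm_eq (map norm J) (map norm K).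
  apply/allP => y; rewrite mem_cat /= => yJK; apply/eqP.
  have -> : y = norm y by case/orP: yJK => /mapP[x _ ->].
  by rewrite -!multE JK.
have /(perm_iotaP 0)[Is pIs EJ] := pJK.
have sJ : size Is = size J by have := congr1 size EJ; rewrite !size_map.
have sK : size J = size K by rewrite -sJ (perm_size pIs) size_iota size_map.
have Isb (i : 'I_(size J)) : (nth 0%N Is i < size K)%N.
  have: nth 0%N Is i \in iota 0 (size (map norm K)).
    by rewrite -(perm_mem pIs) mem_nth ?sJ.
  by rewrite mem_iota size_map.
pose f i := Ordinal (Isb i).
have f_inj : injective f.
  move=> i k [/eqP]; rewrite nth_uniq ?sJ //; first by move/eqP/val_inj.
  by rewrite (perm_uniq pIs) iota_uniq.
apply: (@layers_iso _ _ f) => [|i].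
  by apply: inj_card_bij f_inj _; rewrite !card_ord sK.
have : norm J`_i == norm K`_(f i).
  rewrite -(nth_map 0 0 norm (ltn_ord i)) EJ (nth_map 0%N) ?sJ //.
  by rewrite (nth_map 0).
by rewrite normE => /orP[/eqP|/eqP]; auto.
Qed.

Lemma pm_mult_cat J K x : pm_mult (J ++ K) x = (pm_mult J x + pm_mult K x)%N.
Proof. exact: count_cat. Qed.

Lemma pm_mult_repeat k J x : pm_mult (repeat_params k J) x = (k * pm_mult J x)%N.
Proof.
by elim: k => //= k IHk; rewrite [repeat_params _ _]/(J ++ _) pm_mult_cat IHk mulSn.
Qed.

Lemma scale_repeat k u J :
  scale_params u (repeat_params k J) = repeat_params k (scale_params u J).
Proof.
by rewrite /repeat_params /scale_params map_flatten map_nseq.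
Qed.

(* Up to the unit [u] and signs, [J] consists of [m] copies of [C]; in        *)
(* [transitive_params], of [m] copies of [C] modulo signs.                    *)
Definition cayley_params J := exists u C m,
  (0 < m)%N /\ forall x, pm_mult (scale_params u J) x =
     (m * ((x \in unit_vals C) + (- x \in unit_vals C)))%N.

Definition transitive_params J := exists u C m,
  [/\ (0 < m)%N, -1 \in unit_vals C & forall x,
  pm_mult (scale_params u J) x = (m * (x \in unit_vals C))%N].

Lemma repeat_cayley_params k J : (0 < k)%N ->
  cayley_params J -> cayley_params (repeat_params k J).
Proof.
move=> k0 [u [C [m [m0 H]]]]; exists u, C, (k * m)%N; rewrite muln_gt0 k0.
by split=> // x; rewrite scale_repeat pm_mult_repeat H mulnA.
Qed.

Lemma unit_vals_opp C x : -1 \in unit_vals C ->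
  (- x \in unit_vals C) = (x \in unit_vals C).
Proof.
move=> CN1; have opp y : y \in unit_vals C -> - y \in unit_vals C.
  case/unit_valsP=> c cC ->; case/unit_valsP: CN1 => d dC Ed.
  by apply/unit_valsP; exists (d * c)%g; rewrite ?groupM //= -Ed mulN1r.
by apply/idP/idP=> /opp //; rewrite opprK.
Qed.

(** Two copies of [C] modulo signs make one copy of [C]. *)
Lemma repeat_transitive_params k J : (0 < k)%N -> ~~ odd k ->
  transitive_params J -> cayley_params (repeat_params k J).
Proof.
move=> k0 k2 [u [C [m [m0 CN1 H]]]]; exists u, C, (k./2 * m)%N.
rewrite muln_gt0 m0 half_gt0; split=> [|x]; first by case: k k0 k2 => [|[]].
rewrite scale_repeat pm_mult_repeat H unit_vals_opp // addnn -mul2n.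
rewrite -{1}[k]odd_double_half (negPf k2) add0n -muln2.
by rewrite -!mulnA; congr (_ * _)%N; rewrite mulnCA.
Qed.

End Multiplicity.

(** * Regular groups from copies of a group of units *)

Section Sufficiency.
Variables (n : nat) (hn : (2 < n)%N).
Implicit Types (J K : seq 'Z_n) (C : {group {unit 'Z_n}}).

Lemma pm_mult_uniq K x : uniq K -> {in K, forall j, j \is a GRing.unit} ->
  pm_mult K x = ((x \in K) + (- x \in K))%N.
Proof.
move=> uK KU; rewrite -!count_uniq_mem // -count_predUI.
rewrite [X in (_ + X)%N](_ : _ = 0%N) ?addn0; first exact: eq_count.
apply/eqP; rewrite -leqn0 leqNgt -has_count; apply/hasPn => j /KU uj /=.
apply/andP => -[/eqP jx /eqP jNx]; have /negP[] := unit_double hn uj.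
by rewrite mulr2n {1}jx jNx subrr.
Qed.

Definition units_seq C := [seq val c | c <- enum C].

Lemma mem_units_seq C x : (x \in units_seq C) = (x \in unit_vals C).
Proof.
apply/mapP/unit_valsP => -[c cC ->]; exists c => //.
  by rewrite mem_enum in cC.
by rewrite mem_enum.
Qed.

Lemma uniq_units_seq C : uniq (units_seq C).
Proof. by rewrite map_inj_uniq ?enum_uniq //; apply: val_inj. Qed.

Lemma pm_mult_units_seq C x :
  pm_mult (units_seq C) x = ((x \in unit_vals C) + (- x \in unit_vals C))%N.
Proof.
rewrite pm_mult_uniq ?uniq_units_seq ?mem_units_seq // => j.
by rewrite mem_units_seq => /unit_valsP[c _ ->]; apply: valP.
Qed.

Lemma labelled_cayley J m C (lab : 'I_(size J) -> 'I_m.+1 * {unit 'Z_n}) :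
  (0 < size J)%N -> injective lab ->
  (forall p, reflect (exists i, lab i = p) (p.2 \in C)) ->
  (forall i : 'I_(size J), J`_i = val (lab i).2) -> is_cayley (GI J).
Proof.
move=> J0 lab_inj labP labE.
have labC i : (lab i).2 \in C by apply/labP; exists i.
pose T : finType := ('I_(size J) * 'Z_n)%type.
pose acts (g : {perm T}) a c (b : 'Z_n) := forall x : T,
  lab (g x).1 = ((lab x.1).1 + a, (lab x.1).2 * c)%g /\
  (g x).2 = x.2 * val c + b.
pose G := [set g : {perm T} | [exists t : 'I_m.+1 * {unit 'Z_n} * 'Z_n,
  (t.1.2 \in C) && [forall x : T, (lab (g x).1 ==
    ((lab x.1).1 + t.1.1, (lab x.1).2 * t.1.2)%g) &&
      ((g x).2 == x.2 * val t.1.2 + t.2)]]].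
have GP g : reflect (exists a c b, c \in C /\ acts g a c b) (g \in G).
  rewrite inE; apply: (iffP existsP) => [[[[a c] b] /andP[/= cC /forallP H]]|].
    by exists a, c, b; split=> // x; have /andP[/eqP-> /eqP->] := H x.
  move=> [a [c [b [cC H]]]]; exists (a, c, b); rewrite cC /=.
  by apply/forallP => x; have [-> ->] := H x; rewrite !eqxx.
apply: (@cayley_intro _ _ G (Ordinal J0, 0)).
- apply/GP; exists 0, 1%g, 0; split; first exact: group1.
  by move=> x; rewrite perm1 addr0 mulg1 mulr1 addr0 -surjective_pairing.
- move=> g h /GP[a [c [b [cC gE]]]] /GP[a' [c' [b' [cC' hE]]]]; apply/GP.
  exists (a + a'), (c * c')%g, (b * val c' + b'); split; first exact: groupM.
  move=> x; rewrite permM; have [-> ->] := hE (g x); have [-> ->] := gE x.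
  by rewrite /= addrA !mulgA mulrDl mulrA addrA.
split.
- move=> g /GP[a [c [b [cC gE]]]] x y; rewrite /GI.
  have [g1 g2] := gE x; have [g1' g2'] := gE y.
  have uc : val c \is a GRing.unit by exact: valP.
  have -> : ((g x).1 == (g y).1) = (x.1 == y.1).
    rewrite -(inj_eq lab_inj) g1 g1' -[RHS](inj_eq lab_inj) xpair_eqE.
    rewrite (inj_eq (addIr _)) (inj_eq (mulIg _)) -xpair_eqE.
    by rewrite -!surjective_pairing.
  rewrite g2 g2' (inj_eq (addIr _)) (inj_eq (mulIr uc)); congr (_ || _ && _).
  rewrite !labE g1 /= addrAC -mulrDl (inj_eq (addIr _)) (inj_eq (mulIr uc)).
  by rewrite addrAC -mulrBl (inj_eq (addIr _)) (inj_eq (mulIr uc)).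
- move=> x y; pose a := (lab y.1).1 - (lab x.1).1.
  pose c := ((lab x.1).2^-1 * (lab y.1).2)%g; pose b := y.2 - x.2 * val c.
  have cC : c \in C by rewrite groupM ?groupV.
  have labV p : p.2 \in C -> {i | lab i = p}.
    by move=> pC; apply: sig_eqW; apply/labP.
  have tC i : ((lab i).1 + a, (lab i).2 * c)%g.2 \in C by rewrite groupM.
  pose f z := (sval (labV _ (tC z.1)), z.2 * val c + b).
  have uc : val c \is a GRing.unit by exact: valP.
  have f_inj : injective f.
    move=> [i v] [k w] fE.
    have /= -> := mulIr uc (addIr _ (congr1 snd fE)).
    have E := congr1 lab (congr1 fst fE).
    rewrite /= !(svalP (labV _ _)) in E.
    rewrite (lab_inj i k) // [LHS]surjective_pairing [RHS]surjective_pairing.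
    by rewrite (addIr _ (congr1 fst E)) (mulIg _ _ _ (congr1 snd E)).
  exists (perm f_inj).
    apply/GP; exists a, c, b; split=> // z; rewrite permE /=.
    by rewrite (svalP (labV _ _)).
  rewrite permE /f /b [X in (_, X)]addrC subrK [RHS]surjective_pairing; congr (_, _).
  apply: lab_inj; rewrite (svalP (labV _ _)) /= /a [X in (X, _)]addrC subrK.
  by rewrite mulKVg -surjective_pairing.
- move=> g x /GP[a [c [b [cC gE]]]] gx.
  have [E1 E2] := gE x; move: E1 E2; rewrite gx => E1 E2.
  have [Ea Ec] : a = 0 /\ c = 1%g.
    move/eqP: E1; rewrite {1}[lab _]surjective_pairing xpair_eqE => /andP[].
    rewrite -{1}[(lab _).1]addr0 (inj_eq (addrI _)) => /eqP<-.
    by rewrite -{1}[(lab _).2]mulg1 (inj_eq (mulgI _)) => /eqP<-.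
  have Eb : b = 0.
    by apply: (addrI x.2); rewrite addr0 {2}E2 Ec mulr1.
  apply/permP => y; have [F1 F2] := gE y; rewrite perm1.
  rewrite [LHS]surjective_pairing [RHS]surjective_pairing F2 Ec Eb mulr1 addr0.
  congr (_, _); apply: lab_inj; rewrite F1 Ea Ec addr0 mulg1.
  by rewrite -surjective_pairing.
Qed.

Lemma cayley_params_cayley J : (0 < size J)%N ->
  cayley_params J -> is_cayley (GI J).
Proof.
move=> J0 [u [C [m [m0 mJ]]]]; case: m m0 mJ => // m _ mJ.
pose E := [seq (i, c) | i <- enum 'I_m.+1, c <- enum C].
pose K := [seq val p.2 | p <- E].
have EK : K = repeat_params m.+1 (units_seq C).
  rewrite /K /E map_allpairs /repeat_params; congr flatten.
  rewrite -[m.+1 in RHS]size_enum_ord; by elim: (enum 'I_m.+1) => //= i s ->.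
have JK : graph_iso (GI J) (GI K).
  apply: graph_iso_trans (GI_scale_iso u J) _.
  by apply: pm_mult_iso => x; rewrite EK pm_mult_repeat pm_mult_units_seq mJ.
have sK : size K = size E by rewrite size_map.
have [f _ _] := JK.
have K0 : (0 < size K)%N by apply: leq_ltn_trans (ltn_ord (f (Ordinal J0, 0)).1).
apply: (graph_iso_cayley (Ordinal K0, 0) (graph_iso_sym JK)).
have uE : uniq E.
  by apply: allpairs_uniq => [||[i c] [k d]]; rewrite ?enum_uniq.
have ltE (i : 'I_(size K)) : (i < size E)%N by rewrite -sK.
pose lab (i : 'I_(size K)) := nth (ord0, 1%g) E i.
apply: (@labelled_cayley _ m C lab) => // [i k /eqP|p|i].
- by rewrite nth_uniq ?ltE // => /eqP/val_inj.
- apply: (iffP idP) => [pC|[i <-]].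
    have pE : p \in E.
      by rewrite [p]surjective_pairing allpairs_f ?mem_enum.
    have ip : (index p E < size K)%N by rewrite sK index_mem.
    by exists (Ordinal ip); rewrite /lab nth_index.
  rewrite /lab; have /allpairsP[[k c] [_ cC ->]] := mem_nth (ord0, 1%g) (ltE i).
  by rewrite mem_enum in cC.
- by rewrite (nth_map (ord0, 1%g)) ?ltE.
Qed.

End Sufficiency.

(** * Primitive parameters made of units *)

Section Primitive.
Variables (n : nat) (hn : (2 < n)%N).
Implicit Types (J K : seq 'Z_n) (C : {group {unit 'Z_n}}).

Lemma pm_mult_card J x :
  pm_mult J x = #|[set i : 'I_(size J) | (J`_i == x) || (J`_i == - x)]|.
Proof.
rewrite /pm_mult -sum1_count (big_nth 0) big_mkord -sum1_card.
by apply: eq_bigl => i; rewrite !inE.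
Qed.

Lemma pm_mult_gt0 J x : (0 < pm_mult J x)%N = (x \in J) || (- x \in J).
Proof.
rewrite -has_count; apply/hasP/orP => [[j jJ /orP[/eqP<-|/eqP Ej]]|[xJ|xJ]].
- by left.
- by right; rewrite -Ej.
- by exists x; rewrite /= ?eqxx.
- by exists (- x); rewrite /= ?eqxx ?orbT.
Qed.

Lemma pm_mult_opp J x : pm_mult J (- x) = pm_mult J x.
Proof. by apply: eq_count => j /=; rewrite opprK orbC. Qed.

Lemma mem_pm_set J x : (x \in pm_set J) = (0 < pm_mult J x)%N.
Proof.
rewrite pm_mult_gt0 !inE; congr (_ || _).
by apply/imsetP/idP => [[y yJ ->]|xJ]; [rewrite opprK | exists (- x); rewrite ?opprK].
Qed.

Lemma pm_mult_le1 J x (i k : 'I_(size J)) : (pm_mult J x <= 1)%N ->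
  J`_i = x \/ J`_i = - x -> J`_k = x \/ J`_k = - x -> i = k.
Proof.
rewrite pm_mult_card => /card_le1_eqP H Ji Jk.
by apply: H; rewrite inE; apply/orP; [case: Jk|case: Ji] => ->; rewrite eqxx; auto.
Qed.

Lemma primitive_mult J : 1 \in J -> (forall x, (pm_mult J x <= 1)%N) -> primitive J.
Proof.
move=> J1 mJ; split=> // i k ik.
by split=> E; move: ik; rewrite (pm_mult_le1 (mJ J`_k) (i := i) (k := k)) ?eqxx;
  auto.
Qed.

Lemma units_params K : (0 < size K)%N ->
  {in K, forall j, j \is a GRing.unit} -> GI_params K.
Proof.
move=> K0 KU; split=> // j /KU uj; have := unit_double hn uj.
rewrite (Zn_mulrn_eq0 hn) muln2 => H; split.
  by rewrite lt0n; apply: contraNN H => /eqP->.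
by move=> E; rewrite E dvdnn in H.
Qed.

Lemma affine_aut K (s : 'I_(size K) -> 'I_(size K)) (c b : 'Z_n) :
  injective s -> c \is a GRing.unit ->
  (forall i : 'I_(size K), K`_(s i) = c * K`_i \/ K`_(s i) = - (c * K`_i)) ->
  exists2 g, g \in graph_aut (GI K) & forall x, g x = (s x.1, c * x.2 + b).
Proof.
move=> s_inj uc sK; pose f (x : 'I_(size K) * 'Z_n) := (s x.1, c * x.2 + b).
have f_inj : injective f.
  move=> [i v] [k w] E.
  have /= -> := s_inj _ _ (congr1 fst E).
  by have /= -> := mulrI uc (addIr _ (congr1 snd E)).
exists (perm f_inj); last by move=> x; rewrite permE.
apply/graph_autP => x y; rewrite !permE /f /GI /=.
rewrite (inj_eq s_inj) (inj_eq (addIr b)) (inj_eq (mulrI uc)).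
have E z : ((c * y.2 + b == c * x.2 + b + c * z) = (y.2 == x.2 + z)) *
    ((c * y.2 + b == c * x.2 + b - c * z) = (y.2 == x.2 - z)).
  by rewrite !(addrAC _ b) -mulrDr -mulrBr !(inj_eq (addIr b)) !(inj_eq (mulrI uc)).
by congr (_ || _ && _); case: (sK x.1) => ->; rewrite ?opprK !E // orbC.
Qed.

(** Multiplication by an element of [C] permutes the parameters up to sign, each occurring once,
    hence it induces a permutation of the layers; translations move the residues. *)
Lemma units_transitive K C : (0 < size K)%N ->
  (forall x, pm_mult K x = (x \in unit_vals C)) -> vertex_transitive (GI K).
Proof.
move=> K0 mK; have KC (i : 'I_(size K)) : K`_i \in unit_vals C.
  have: (0 < pm_mult K (K`_i)%R)%N by rewrite pm_mult_gt0 mem_nth.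
  by rewrite mK lt0b.
have mK1 x : (pm_mult K x <= 1)%N by rewrite mK leq_b1.
apply/(transitiveP _ (Ordinal K0, 0)) => x y.
have /unit_valsP[cx Cx Ex] := KC x.1; have /unit_valsP[cy Cy Ey] := KC y.1.
pose c := (cx^-1 * cy)%g; have cC : c \in C by rewrite groupM ?groupV.
have uc : val c \is a GRing.unit by exact: valP.
pose P i k := (K`_k == val c * K`_i) || (K`_k == - (val c * K`_i)).
pose s (i : 'I_(size K)) : 'I_(size K) := odflt i [pick k : 'I_(size K) | P i k].
have sP (i : 'I_(size K)) : P i (s i).
  rewrite /s; case: pickP => //= none.
  have : (0 < pm_mult K (val c * K`_i)%R)%N.
    have /unit_valsP[d dC ->] := KC i.
    by rewrite mK lt0b; apply/unit_valsP; exists (c * d)%g; first exact: groupM.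
  rewrite pm_mult_card => /card_gt0P[k]; rewrite inE => Pk.
  by have := none k; rewrite /P Pk.
have {}sP (i : 'I_(size K)) :
    K`_(s i) = val c * K`_i \/ K`_(s i) = - (val c * K`_i).
  by have /orP[/eqP|/eqP] := sP i; auto.
have s_inj : injective s.
  move=> i k sik; apply: (pm_mult_le1 (mK1 K`_k)); last by left.
  have Ei := sP i; have Ek := sP k; rewrite sik in Ei.
  case: Ei => Ei; case: Ek; rewrite Ei -?mulrN => /(mulrI uc); auto.
    by move=> <-; rewrite opprK; right.
  by move/oppr_inj; left.
have [g gG gE] := affine_aut (y.2 - val c * x.2) s_inj uc sP.
exists g => //; rewrite gE addrC subrK [RHS]surjective_pairing; congr (_, _).
apply: (pm_mult_le1 (mK1 K`_y.1)); last by left.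
have Ec : val c * K`_x.1 = K`_y.1.
  rewrite Ex Ey /= mulrAC mulVr ?mul1r //; exact: valP.
by rewrite -Ec; apply: sP.
Qed.

(** When -1 lies in [C], one representative of each pair [x], [- x]. *)
Definition half_units C := [seq x <- units_seq C | ((val x).*2 < n)%N].

Lemma pm_mult_half_units C x : -1 \in unit_vals C ->
  pm_mult (half_units C) x = (x \in unit_vals C).
Proof.
move=> CN1; rewrite pm_mult_uniq ?filter_uniq ?uniq_units_seq //; last first.
  move=> j; rewrite mem_filter mem_units_seq => /andP[_ /unit_valsP[c _ ->]].
  exact: valP.
rewrite !mem_filter !mem_units_seq unit_vals_opp //.
have [xC|] := boolP (x \in _); last by rewrite !andbF.
rewrite !andbT; have ux : x \is a GRing.unit.
  by have /unit_valsP[c _ ->] := xC; apply: valP.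
have := unit_double hn ux; rewrite (Zn_mulrn_eq0 hn) muln2 => x2.
have n1 : (1 < n)%N := ltnW hn.
have x0 : (0 < val x)%N by rewrite lt0n; apply: contraNN x2 => /eqP->.
have xn : (val x < n)%N by have := ltn_ord x; rewrite [X in (_ < X)%N]Zp_cast.
have -> : val (- x) = (n - val x)%N.
  rewrite /= [X in (X - _)%N]Zp_cast // [X in (_ %% X)%N]Zp_cast // modn_small //.
  by rewrite ltn_subrL x0 (ltn_trans _ n1).
have {}x2 : (val x).*2 != n by apply: contraNN x2 => /eqP->.
by move: x0 xn x2; move: (val x) => v; lia.
Qed.

Lemma half_units_bound C : (size (half_units C) <= uphalf n)%N.
Proof.
rewrite -(size_map val) -(size_iota 0 (uphalf n)).
apply: uniq_leq_size.
  by rewrite (map_inj_uniq val_inj) filter_uniq ?uniq_units_seq.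
move=> i /mapP[j]; rewrite mem_filter => /andP[jn _] ->.
by move: jn; rewrite mem_iota; move: (val j) => v /=; lia.
Qed.

Lemma half_units_unit C : {in half_units C, forall j, j \is a GRing.unit}.
Proof.
move=> j; rewrite mem_filter mem_units_seq => /andP[_ /unit_valsP[c _ ->]].
exact: valP.
Qed.

Lemma one_unit_vals C : 1 \in unit_vals C.
Proof. by apply/unit_valsP; exists 1%g; rewrite ?group1. Qed.

Lemma one_half_units C : 1 \in half_units C.
Proof.
rewrite mem_filter mem_units_seq one_unit_vals andbT.
by have -> : val (1 : 'Z_n) = 1%N by [].
Qed.

(** Units modulo an even [n] are odd, so the parity of layer index plus residue alternates along
    edges. *)
Lemma even_bipartite J : ~~ odd n -> (size J <= 2)%N ->
  {in J, forall j, j \is a GRing.unit} ->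
  exists f : 'I_(size J) * 'Z_n -> bool, forall x y, GI J x y -> f y = ~~ f x.
Proof.
move=> n2 J2 JU; exists (fun x : 'I_(size J) * 'Z_n => odd (x.1 + x.2)%N).
have n1 : (1 < n)%N := ltnW hn.
have odd_add (v w : 'Z_n) : odd (v + w)%R = odd v (+) odd w.
  have -> : (v + w)%R = ((val v + val w) %% (Zp_trunc n).+2)%N :> nat by [].
  rewrite [X in (_ %% X)%N]Zp_cast // -oddD.
  by rewrite [in RHS](divn_eq (v + w) n) [RHS]oddD oddM (negPf n2) andbF.
have oddJ (i : 'I_(size J)) : odd (J`_i)%R.
  have := JU _ (mem_nth 0 (ltn_ord i)).
  rewrite -{1}[(J`_i)%R]natr_Zp unitZpE // => H.
  rewrite -coprime2n; apply: coprime_dvdl H.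
  by rewrite dvdn2.
move=> x y /orP[/andP[xy /eqP <-]|/andP[/eqP <-]].
  rewrite !oddD -addNb; congr (_ (+) _).
  move: xy; rewrite -val_eqE /=.
  have := ltn_ord x.1; have := ltn_ord y.1.
  by move: (val x.1) (val y.1) => [|[|a]] [|[|b]] //=; lia.
case/orP => /eqP E; first by rewrite E !oddD odd_add oddJ addbT addbN.
have -> : x.2 = y.2 + (J`_x.1)%R by rewrite E subrK.
by rewrite !oddD odd_add oddJ addbT addbN negbK.
Qed.

Lemma dodecahedral_C5 :
  let v (i : 'I_2) (k : nat) : 'I_(size [:: 1; 2 : 'Z_10]) * 'Z_10 := (i, inZp k) in
  [/\ dodecahedral_graph (v ord0 0%N) (v ord0 1%N),
      dodecahedral_graph (v ord0 1%N) (v ord0 2%N),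
      dodecahedral_graph (v ord0 2%N) (v ord_max 2%N),
      dodecahedral_graph (v ord_max 2%N) (v ord_max 0%N) &
      dodecahedral_graph (v ord_max 0%N) (v ord0 0%N)].
Proof. by split; vm_compute. Qed.

(** Twenty vertices and at most [(n + 1) / 2] layers leave one layer with [n = 20] or two with
    [n = 10]. Both graphs are bipartite, whereas the dodecahedral graph has a 5-cycle. *)
Lemma half_units_not_dodecahedral C : -1 \in unit_vals C ->
  ~ graph_iso (GI (half_units C)) dodecahedral_graph.
Proof.
move=> CN1 iso.
have [f fb _] := iso.
have : (size (half_units C) * n = 20)%N.
  have := bij_eq_card fb; rewrite !card_prod !card_ord /=.
  by rewrite [X in (_ * X)%N = _]Zp_cast // (ltnW hn).
have := half_units_bound C; set s := size _ => sn sn20.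
have [n2 s2] : ~~ odd n /\ (s <= 2)%N.
  have : (s * n <= 20)%N by rewrite sn20.
  have : (s <= 6)%N by nia.
  move: sn20 sn; clear; case: s => [|[|[|[|[|[|[|s]]]]]]] //; lia.
have [col colP] := even_bipartite n2 s2 (@half_units_unit C).
have [h _ hE] := graph_iso_sym iso.
have := dodecahedral_C5; set v := fun i k => _ => /= -[].
rewrite -!hE => /colP E1 /colP E2 /colP E3 /colP E4 /colP.
by rewrite E4 E3 E2 E1; case: (col _).
Qed.

End Primitive.

(** * From copies of a group to the two alternatives *)

Section Alternatives.
Variables (n : nat) (hn : (2 < n)%N).
Implicit Types (J K : seq 'Z_n) (C : {group {unit 'Z_n}}).

Definition unitN1 : {unit 'Z_n} := FinRing.unit 'Z_n (unitrN1 _).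

Lemma scale_unitN1 u J :
  scale_params (u * unitN1)%g J = [seq - j | j <- scale_params u J].
Proof.
by rewrite /scale_params -map_comp; apply: eq_map => j /=; rewrite mulrN1 mulNr.
Qed.

Lemma pm_mult_map_opp J x : pm_mult [seq - j | j <- J] x = pm_mult J x.
Proof.
rewrite /pm_mult count_map; apply: eq_count => j /=.
by rewrite eqr_oppLR eqr_opp orbC.
Qed.

Lemma unit_commute (a b : {unit 'Z_n}) : (a * b = b * a)%g.
Proof. by apply: val_inj; rewrite /= mulrC. Qed.

Lemma unit_mulN1 C c : -1 \notin unit_vals C -> c \in C -> (c * unitN1)%g \notin C.
Proof.
move=> CN1 cC; apply: contra CN1 => cN; apply/unit_valsP.
by exists unitN1 => //; rewrite -(groupMl _ cC).
Qed.

Lemma unit_vals_le1 C x : -1 \notin unit_vals C ->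
  ((x \in unit_vals C) + (- x \in unit_vals C) <= 1)%N.
Proof.
move=> CN1; have [/unit_valsP[c cC ->]|] := boolP (x \in unit_vals C).
  have := unit_mulN1 CN1 cC.
  by rewrite -(mem_unit_vals C) /= mulrN1 => /negPf->.
by rewrite leq_b1.
Qed.

(** The group is the union of [C] and [- C]. *)
Lemma pm_group C : exists A : {group {unit 'Z_n}},
  [/\ C \subset A,
      -1 \notin unit_vals C -> #|A| = (#|C| * 2)%N &
      forall x, (x \in unit_vals A) =
        (x \in unit_vals C) || (- x \in unit_vals C)].
Proof.
have NN : (unitN1 * unitN1 = 1)%g by apply: val_inj; rewrite /= mulrNN mulr1.
pose A := (C :|: C :* unitN1)%g.
have AP a : (a \in A) = (a \in C) || ((a * unitN1)%g \in C).
  by rewrite inE mem_rcoset -[X in (_ * X)%g]mul1g -NN mulgK.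
have gA : group_set A.
  apply/group_setP; rewrite AP group1; split=> // a b; rewrite !AP.
  have E : (a * b = a * unitN1 * (b * unitN1))%g.
    by rewrite (unit_commute b) mulgA -(mulgA a) NN mulg1.
  case/orP=> [aC|aNC] /orP[bC|bNC].
  - by rewrite groupM.
  - by rewrite -mulgA (groupM aC bNC) orbT.
  - by rewrite -mulgA (unit_commute b) mulgA (groupM aNC bC) orbT.
  - by rewrite E groupM.
exists (Group gA); split=> [|CN1|x]; first exact: subsetUl.
  rewrite /= cardsU card_rcoset (_ : C :&: _ = set0)%g ?cards0.
    by rewrite subn0 addnn muln2.
  apply/setP => a; rewrite !inE mem_rcoset -[X in (_ * X)%g]mul1g -NN mulgK.
  by apply/andP => -[/(unit_mulN1 CN1)/negP].
apply/unit_valsP/orP => [[a]|[]].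
- rewrite AP => /orP[aC ->|aC ->]; first by left; rewrite mem_unit_vals.
  by right; apply/unit_valsP; exists (a * unitN1)%g => //=; rewrite mulrN1.
- by case/unit_valsP=> c cC ->; exists c; rewrite ?AP ?cC.
case/unit_valsP=> c cC xE; exists (c * unitN1)%g; last first.
  by rewrite /= -xE mulrN1 opprK.
by rewrite AP -mulgA NN mulg1 cC orbT.
Qed.

Lemma cayley_transitive_params J : cayley_params J -> transitive_params J.
Proof.
case=> u [C [m [m0 mJ]]].
have [CN1|CN1] := boolP (-1 \in unit_vals C).
  exists u, C, (2 * m)%N; split=> // [|x]; first by rewrite muln_gt0.
  by rewrite mJ unit_vals_opp // addnn -mul2n mulnCA mulnA.
have [A [_ _ AC]] := pm_group C.
exists u, A, m; split=> // [|x]; first by rewrite AC opprK one_unit_vals orbT.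
rewrite mJ AC; have := unit_vals_le1 x CN1.
by do 2 case: (_ \in _).
Qed.

Lemma primitive_subgroup_units K C : -1 \notin unit_vals C -> 1 \in K ->
  (forall x, pm_mult K x = ((x \in unit_vals C) + (- x \in unit_vals C))%N) ->
  primitive_subgroup K.
Proof.
move=> CN1 K1 mK.
have [A [CA cA AC]] := pm_group C.
have mK1 x : (pm_mult K x <= 1)%N by rewrite mK unit_vals_le1.
split; first exact: primitive_mult.
exists A; split; last first.
  exists C; split=> //.
  by rewrite -divgS // cA // mulKn ?cardG_gt0.
by apply/setP => x; rewrite mem_pm_set mK addn_gt0 !lt0b AC.
Qed.

Lemma cayley_params_alternatives J : GI_params J -> cayley_params J ->
  (exists u : {unit 'Z_n}, primitive_subgroup (scale_params u J)) \/
  (exists (J0 : seq 'Z_n) (k0 : nat),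
     [/\ GI_params J0, primitive J0, (1 < k0)%N,
         graph_iso (GI J) (GI (repeat_params k0 J0)) &
         is_cayley (GI J0)
         \/ [/\ ~~ odd k0, vertex_transitive (GI J0) &
                ~ graph_iso (GI J0) dodecahedral_graph]]).
Proof.
move=> pJ [u [C [m [m0 mJ]]]].
have isoK K k : (forall x, (m * ((x \in unit_vals C) + (- x \in unit_vals C)))%N
    = (k * pm_mult K x)%N) -> graph_iso (GI J) (GI (repeat_params k K)).
  move=> mK; apply: graph_iso_trans (GI_scale_iso u J) _.
  by apply: pm_mult_iso => x; rewrite pm_mult_repeat mJ mK.
(* If -1 lies in [C], each copy of [C] is two copies of its half up to signs, whence the even number
   [2 * m]. *)
have [CN1|CN1] := boolP (-1 \in unit_vals C).
  right; exists (half_units C), (2 * m)%N.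
  have K1 := one_half_units hn C.
  have mK x := pm_mult_half_units hn x CN1.
  have K0 : (0 < size (half_units C))%N by case: half_units K1.
  split.
  - by apply: units_params K0 _ => //; apply: half_units_unit.
  - by apply: primitive_mult => // x; rewrite mK leq_b1.
  - by case: m m0 {mJ isoK} => // m _; rewrite mulnS.
  - by apply: isoK => x; rewrite mK unit_vals_opp // addnn -mul2n mulnCA mulnA.
  right; split; first by rewrite oddM.
    exact: units_transitive K0 mK.
  exact: half_units_not_dodecahedral.
have C1 := one_unit_vals C.
have [m1|m1] := leqP m 1; [left | right].
  have {m1 m0} m1 : m = 1%N by apply/eqP; rewrite eqn_leq m1 m0.
  subst m; have := pm_mult_gt0 (scale_params u J) 1.
  (* The scaled parameters contain 1 only up to sign; in the second case [u] is replaced by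
     [- u]. *)
  rewrite mJ mul1n C1 => /esym/orP[J1|J1]; [exists u | exists (u * unitN1)%g].
    by apply: primitive_subgroup_units CN1 J1 _ => x; rewrite mJ mul1n.
  apply: primitive_subgroup_units CN1 _ _ => [|x].
    by rewrite scale_unitN1 -[1]opprK map_f.
  by rewrite scale_unitN1 pm_mult_map_opp mJ mul1n.
exists (units_seq C), m.
have K1 : 1 \in units_seq C by rewrite mem_units_seq.
have K0 : (0 < size (units_seq C))%N by case: units_seq K1.
have mK x := pm_mult_units_seq hn C x.
split=> //.
- apply: units_params => // j; rewrite mem_units_seq => /unit_valsP[c _ ->].
  exact: valP.
- apply: primitive_mult => // x; rewrite mK.
  exact: unit_vals_le1.
- by apply: isoK => x; rewrite mK.
left; apply: cayley_params_cayley => //.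
exists 1%g, C, 1%N; split=> // x; rewrite mul1n -mK; congr pm_mult.
by rewrite /scale_params -[RHS]map_id; apply: eq_map => j; rewrite mul1r.
Qed.

End Alternatives.

(** * Transitive groups that permute the spokes *)

Section Respecting.
Variables (n : nat) (hn : (2 < n)%N) (J : seq 'Z_n).
Hypotheses (pJ : GI_params J) (spJ : spans J).
Let T : finType := ('I_(size J) * 'Z_n)%type.
Implicit Types (x y : T) (g : {perm T}) (i : 'I_(size J)).

Definition spoke x y := (x.1 != y.1) && (x.2 == y.2).

Variable G : {group {perm T}}.
Hypothesis Ge : forall g, g \in G -> forall x y, GI J (g x) (g y) = GI J x y.
Hypothesis Gtr : forall x y, exists2 g, g \in G & g x = y.
Hypothesis Gspoke : forall g, g \in G -> forall x y, spoke x y -> spoke (g x) (g y).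

Let n1 : (1 < n)%N := ltnW hn.
Let i0 := Ordinal (proj1 pJ).

Let double i : J`_i *+ 2 != 0.
Proof. by apply: params_double pJ _; rewrite ?mem_nth. Qed.

Let layer_step g i v : g \in G -> let y := g (i, v) in
  g (i, v + J`_i) = (y.1, y.2 + J`_y.1) \/ g (i, v + J`_i) = (y.1, y.2 - J`_y.1).
Proof.
move=> gG y; set z := g (i, _).
have yz : GI J y z by rewrite Ge // /GI /= !eqxx orbT.
have nsp : ~~ spoke y z.
  apply/negP => /(Gspoke (groupVr gG)); rewrite !permK /spoke /=.
  by rewrite eqxx.
case/orP: yz => [yz|/andP[/eqP y1 /orP[]/eqP y2]].
- by rewrite /spoke yz in nsp.
- by left; rewrite -y2 y1 -surjective_pairing.
- by right; rewrite -y2 y1 -surjective_pairing.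
Qed.

(** The direction taken at the first step persists: turning back would identify the images of two
    vertices whose residues differ by twice the parameter, which is nonzero. *)
Let layer_run g i v : g \in G -> let y := g (i, v) in
  exists2 e, e = J`_y.1 \/ e = - J`_y.1 &
  forall k, g (i, v + J`_i *+ k) = (y.1, y.2 + e *+ k).
Proof.
move=> gG y.
have [e eE ge] : exists2 e, e = J`_y.1 \/ e = - J`_y.1 &
    g (i, v + J`_i) = (y.1, y.2 + e).
  by case: (layer_step i v gG) => E; [exists (J`_y.1) | exists (- J`_y.1)]; auto.
exists e => // k.
suff [] : g (i, v + J`_i *+ k) = (y.1, y.2 + e *+ k) /\
  g (i, v + J`_i *+ k.+1) = (y.1, y.2 + e *+ k.+1) by [].
elim: k => [|k [IH0 IH1]]; first by rewrite !addr0 -surjective_pairing.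
split=> //; have := layer_step i (v + J`_i *+ k.+1) gG.
rewrite IH1 /= -addrA -mulrSr => E.
have {E} [//|E] : g (i, v + J`_i *+ k.+2) = (y.1, y.2 + e *+ k.+2) \/
    g (i, v + J`_i *+ k.+2) = (y.1, y.2 + e *+ k).
  have Ep : y.2 + e *+ k.+2 = y.2 + e *+ k.+1 + e by rewrite -addrA -mulrSr.
  have Em : y.2 + e *+ k = y.2 + e *+ k.+1 - e by rewrite mulrSr addrA addrK.
  by rewrite Ep Em; case: eE E => -> [] ->; rewrite ?opprK; auto.
have /perm_inj/(congr1 snd)/addrI/eqP :
    g (i, v + J`_i *+ k.+2) = g (i, v + J`_i *+ k).
  by rewrite E IH0.
by rewrite -subr_eq0 -[k.+2]addn2 mulrnDr addrC addKr (negPf (double i)).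
Qed.

(** An element of [G] from layer [i] to another layer carries a run of [m] steps that closes up to
    such a run. Hence a multiplier that kills one parameter kills all of them. *)
Lemma respecting_unit i : J`_i \is a GRing.unit.
Proof.
apply: (Zn_unit hn) => m im; apply: spJ => j /(nthP 0)[k kJ <-].
have [g gG gE] := Gtr (i, 0) (Ordinal kJ, 0).
have [e eE run] := layer_run i 0 gG.
have /(congr1 snd) := run m; rewrite im addr0 gE /= add0r => /esym em.
case: eE em; rewrite gE /= => -> //.
by rewrite mulNrn => /eqP; rewrite oppr_eq0 => /eqP.
Qed.

(** Inside a layer the map is a run. The residue of the image is constant on a spoke, so slope and
    constant term are common to all layers. *)
Lemma respecting_affine g : g \in G -> exists s a b,
  (forall x, g x = (s x.1, x.2 * a + b)) /\
  (forall i, J`_(s i) = a * J`_i \/ J`_(s i) = - (a * J`_i)).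
Proof.
move=> gG; pose s i := (g (i, 0)).1; pose b := (g (i0, 0)).2.
have same i k v : (g (i, v)).2 = (g (k, v)).2.
  have [->//|ik] := eqVneq i k.
  by have /(Gspoke gG)/andP[_ /eqP] : spoke (i, v) (k, v) by rewrite /spoke ik /=.
have run i : exists2 e, e = J`_(s i) \/ e = - J`_(s i) &
    forall v, g (i, v) = (s i, b + e * ((J`_i)^-1 * v)).
  have [e eE ge] := layer_run i 0 gG; exists e => // v.
  have := ge (val ((J`_i)^-1 * v)); rewrite add0r (same i i0).
  rewrite -(mulr_natr e) -(mulr_natr J`_i) natr_Zp mulrA mulrV ?mul1r //.
  exact: respecting_unit.
exists s, ((g (i0, 1)).2 - b), b.
have aE i e : (forall v, g (i, v) = (s i, b + e * ((J`_i)^-1 * v))) ->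
    (g (i0, 1)).2 - b = e * (J`_i)^-1.
  by move=> ge; rewrite (same i0 i) ge /= mulr1 addrC addKr.
split=> [[i v]|i]; have [e eE ge] := run i.
  rewrite ge (aE _ _ ge) /=; congr (_, _); rewrite addrC; congr (_ + _).
  by rewrite mulrA mulrC.
rewrite (aE _ _ ge) mulrVK ?respecting_unit //.
by case: eE => ->; rewrite ?opprK; auto.
Qed.


Let u : {unit 'Z_n} := ((FinRing.unit 'Z_n (respecting_unit i0))^-1)%g.
Let K := scale_params u J.

Let K_mult (r : 'Z_n) : pm_mult K r = pm_mult J (J`_i0 * r).
Proof.
have uJ := respecting_unit i0.
rewrite /pm_mult /K count_map; apply: eq_count => j /=.
by rewrite -mulrN -!(can2_eq (mulVKr uJ) (mulKr uJ)).
Qed.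

(** The stabiliser, up to signs, of the multiset [K], which is [J] divided by one of its entries so
    as to contain 1. *)
Definition mult_stab : {set {unit 'Z_n}} :=
  [set c | [forall r, pm_mult K (val c * r) == pm_mult K r]].
Let C := mult_stab.

Let CP c : reflect (forall r, pm_mult K (val c * r) = pm_mult K r) (c \in C).
Proof.
by rewrite inE; apply: (iffP forallP) => H r; apply/eqP; rewrite H.
Qed.

Let gC : group_set C.
Proof.
apply/group_setP; split; first by apply/CP => r; rewrite mul1r.
by move=> c d /CP cC /CP dC; apply/CP => r; rewrite /= -mulrA cC dC.
Qed.

Let affine_C (s : 'I_(size J) -> 'I_(size J)) (c : {unit 'Z_n}) : injective s ->
  (forall i, J`_(s i) = val c * J`_i \/ J`_(s i) = - (val c * J`_i)) -> c \in C.
Proof.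
move=> s_inj sJ; apply/CP => r; rewrite !K_mult mulrCA.
have uc : val c \is a GRing.unit by exact: valP.
move: (J`_i0 * r) => {}r; rewrite !pm_mult_card -(card_preimset _ s_inj).
apply: eq_card => i; rewrite !inE.
case: (sJ i) => ->; rewrite -?mulrN !(inj_eq (mulrI uc)) //.
by rewrite eqr_oppLR eqr_opp orbC.
Qed.

Let CN1 : -1 \in unit_vals C.
Proof.
apply/unit_valsP; exists (unitN1 n) => //.
by apply/CP => r; rewrite /= mulN1r pm_mult_opp.
Qed.

Let oppC (r : 'Z_n) : (- r \in unit_vals C) = (r \in unit_vals C).
Proof. exact: (@unit_vals_opp n (Group gC) r CN1). Qed.

Let affine g : g \in G -> exists s (c : {unit 'Z_n}) b,
  [/\ forall x, g x = (s x.1, x.2 * val c + b), c \in C &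
      forall i, J`_(s i) = val c * J`_i \/ J`_(s i) = - (val c * J`_i)].
Proof.
move=> gG; have [s [a [b [gE sJ]]]] := respecting_affine gG.
have ua : a \is a GRing.unit.
  have := respecting_unit (s i0); rewrite -(unitrMl a (respecting_unit i0)).
  by case: (sJ i0) => ->; rewrite ?unitrN.
exists s, (FinRing.unit 'Z_n ua), b; split=> //.
apply: (affine_C (s := s)) => // i k sik.
have : g (i, 0) = g (k, 0) by rewrite !gE /= sik.
by move/perm_inj/(congr1 fst).
Qed.

Let uE : val u * J`_i0 = 1.
Proof. by rewrite /u /= mulVr //; exact: (respecting_unit i0). Qed.

Let K1 : 1 \in K.
Proof.
by apply/mapP; exists (J`_i0); [rewrite mem_nth | rewrite uE].
Qed.

(** An element of [G] that moves layer [i0] to layer [i] at residue 0 has as multiplier, up to sign,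
    the quotient of the two parameters. So every entry of [K] lies in [C]. *)
Let orbit i : exists g s (c : {unit 'Z_n}),
  [/\ g \in G, forall x, g x = (s x.1, x.2 * val c), c \in C &
      val u * J`_i = val c \/ val u * J`_i = - val c].
Proof.
have [g gG g0] := Gtr (i0, 0) (i, 0).
have [s [c [b [gE cC sJ]]]] := affine gG.
have [si b0] : s i0 = i /\ b = 0.
  move: g0; rewrite gE /= mul0r add0r => E.
  by split; [apply: (congr1 fst E) | apply: (congr1 snd E)].
exists g, s, c; split=> // [x|]; first by rewrite gE b0 addr0.
have := sJ i0; rewrite si; case=> ->; [left | right].
  by rewrite mulrCA uE mulr1.
by rewrite mulrN mulrCA uE mulr1.
Qed.

Let m := pm_mult K 1.

Let m_gt0 : (0 < m)%N.
Proof. by rewrite pm_mult_gt0 K1. Qed.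

Let multE (r : 'Z_n) : pm_mult K r = (m * (r \in unit_vals C))%N.
Proof.
have [/unit_valsP[c /CP cC ->]|rC] := boolP (r \in _).
  by rewrite muln1 -[val c]mulr1 cC.
rewrite muln0; apply/eqP; rewrite -leqn0 leqNgt pm_mult_gt0.
have KC j : j \in K -> j \in unit_vals C.
  case/mapP=> j' /(nthP 0)[k kJ <-] ->.
  have [g [s [c [_ _ cC]]]] := orbit (Ordinal kJ).
  by rewrite /=; case=> ->; rewrite ?oppC mem_unit_vals.
by apply: contra rC => /orP[/KC //|/KC]; rewrite oppC.
Qed.

Lemma respecting_transitive_params : transitive_params J.
Proof. by exists u, (Group gC), m. Qed.

Section Regular.
Hypothesis Gfree : forall g x, g \in G -> g x = x -> g = 1%g.
Hypothesis m_odd : odd m.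

(** The multipliers of the elements of [G] that stabilise the spoke at residue 0. *)
Let B := [set c : {unit 'Z_n} |
  [exists g in G, forall x : T, (g x).2 == x.2 * val c]].

Let BP c : reflect (exists2 g, g \in G & forall x, (g x).2 = x.2 * val c) (c \in B).
Proof.
rewrite inE; apply: (iffP exists_inP) => -[g gG gc]; exists g => //.
  by move=> x; apply/eqP; have /forallP := gc.
by apply/forallP => x; rewrite gc.
Qed.

Let gB : group_set B.
Proof.
apply/group_setP; split.
  by apply/BP; exists 1%g; rewrite ?group1 // => x; rewrite perm1 mulr1.
move=> c d /BP[g gG gc] /BP[h hG hd]; apply/BP; exists (g * h)%g.
  exact: groupM.
by move=> x; rewrite permM hd gc mulrA.
Qed.

Let BC c : c \in B -> c \in C.
Proof.
case/BP=> g gG gc; have [s [d [b [gE dC _]]]] := affine gG.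
suff -> : c = d by [].
apply: val_inj; have := gc (i0, 1); have := gc (i0, 0).
by rewrite !gE /= !mul0r !mul1r add0r => ->; rewrite addr0.
Qed.

Let BN1 : -1 \notin unit_vals B.
Proof.
apply/negP => /unit_valsP[c /BP[g gG gc] cN1].
have {}gc x : (g x).2 = - x.2 by rewrite gc -cN1 mulrN1.
(* A 2-element acts on the odd number [m] of layers [s] with [J`_s = +- J`_i0], *)
(* hence fixes a vertex of the spoke at 0.                                      *)
pose q := (#[g]%g`_2^')%N; have q_odd : odd q by rewrite odd_2'nat part_pnat.
pose h := (g ^+ q)%g; have hG : h \in G by rewrite groupX.
have hN x : (h x).2 = - x.2.
  have H k y : ((g ^+ k)%g y).2 = (-1) ^+ k * y.2.
    elim: k => [|k IHk]; first by rewrite perm1 mul1r.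
    by rewrite expgSr permM gc IHk exprS mulN1r mulNr.
  by rewrite H -signr_odd q_odd mulN1r.
have [s [d [b [hE _ sJ]]]] := affine hG.
have [b0 dN1] : b = 0 /\ val d = -1.
  have := hN (i0, 0); rewrite hE /= mul0r add0r oppr0 => b0.
  by have := hN (i0, 1); rewrite hE b0 /= mul1r addr0.
pose A := [set i : 'I_(size J) | (J`_i == J`_i0) || (J`_i == - J`_i0)].
have A_odd : odd #|A|.
  by rewrite -pm_mult_card -[J`_i0]mulr1 -K_mult.
pose X := setX A [set 0 : 'Z_n].
have hX : [acts <[h]>%g, on X | 'P].
  rewrite cycle_subG; apply/astabsP => x; rewrite /= apermE !inE hN oppr_eq0.
  rewrite hE /=; congr (_ && _).
  by case: (sJ x.1) => ->; rewrite dN1 mulN1r ?opprK // eqr_opp eqr_oppLR orbC.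
have h2 : (2.-group <[h]>)%g.
  rewrite /pgroup; apply: (pnat_dvd _ (part_pnat _ #[g]%g)).
  by rewrite order_dvdn -expgM mulnC partnC ?order_gt0 ?expg_order.
have := pgroup_fix_mod h2 hX.
rewrite cardsX cards1 muln1 !modn2 A_odd => /(congr1 odd)/=.
have [->|[x]] := set_0Vmem ('Fix_(X | 'P)(<[h]>))%g; first by rewrite cards0.
rewrite afix_cycle => /setIP[_ /afix1P hx] _.
have h1 := Gfree hG hx.
have := hN (i0, 1); rewrite h1 perm1 /= => /eqP.
by rewrite (negPf (one_neqN1 hn)).
Qed.

(** By [orbit] and [BN1], exactly one of [c] and [- c] lies in [B] for each [c] in [C]. *)
Lemma regular_odd_params : cayley_params J.
Proof.
exists u, (Group gB), m; split=> // r; rewrite multE; congr (_ * _)%N.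
have [/unit_valsP[c cC ->]|rC] := boolP (r \in unit_vals C); last first.
  have BCv (w : 'Z_n) : w \in unit_vals B -> w \in unit_vals C.
    by case/unit_valsP=> c /BC cC ->; rewrite mem_unit_vals.
  rewrite !(negPf (contra (BCv _) _)) //.
  by rewrite oppC.
apply/eqP; rewrite eq_sym eqn_leq (@unit_vals_le1 _ (Group gB)) //=.
have : (0 < pm_mult K (val c))%N by rewrite multE mem_unit_vals cC muln1.
rewrite pm_mult_gt0 addn_gt0 !lt0b => cK.
have BK i : val u * J`_i \in unit_vals B \/ - (val u * J`_i) \in unit_vals B.
  have [g [s [d [gG gE dC H]]]] := orbit i.
  have dB : val d \in unit_vals B.
    by rewrite mem_unit_vals; apply/BP; exists g => // x; rewrite gE.
  by case: H => ->; [left | right; rewrite opprK].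
case/orP: cK => /mapP[j /(nthP 0)[k kJ <-] E].
  by apply/orP; rewrite E; apply: (BK (Ordinal kJ)).
by apply/orP/or_comm; rewrite -{2}[val c]opprK E; apply: (BK (Ordinal kJ)).
Qed.

End Regular.

(** For even [m], as [C] contains -1, [m] copies of [C] modulo signs are [m / 2] copies of [C]. *)
Lemma respecting_cayley_params :
  (forall g x, g \in G -> g x = x -> g = 1%g) -> cayley_params J.
Proof.
move=> Gfree; have [mo|me] := boolP (odd m); first exact: regular_odd_params.
exists u, (Group gC), m./2; split=> [|r].
  by rewrite half_gt0; case: m m_gt0 me => [|[]].
rewrite multE oppC addnn -mul2n mulnA muln2; congr (_ * _)%N.
by rewrite -{1}[m]odd_double_half (negPf me).
Qed.

End Respecting.

(** * Three or more layers: triangles tell spokes from layer edges *)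

Section CommonNeighbours.
Variables (n : nat) (hn : (2 < n)%N) (J : seq 'Z_n).
Hypotheses (pJ : GI_params J) (spJ : spans J).
Let T : finType := ('I_(size J) * 'Z_n)%type.
Implicit Types (x y : T) (g : {perm T}) (i : 'I_(size J)).

Definition common_neighbours x y := [set z | GI J x z && GI J y z].

Let double i : J`_i *+ 2 != 0.
Proof. by apply: params_double pJ _; rewrite ?mem_nth. Qed.

Lemma spoke_common x y : spoke x y ->
  (size J <= #|common_neighbours x y| + 2)%N.
Proof.
case/andP=> xy1 /eqP xy2; pose A := ~: [set x.1; y.1].
have sA : size J = (#|A| + 2)%N.
  by rewrite -[2%N]/(true.+1) -xy1 -cards2 addnC cardsC card_ord.
rewrite [X in (X <= _)%N]sA leq_add2r.
rewrite -(card_imset _ (f := fun i => (i, x.2) : T)); last first.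
  by move=> i k /(congr1 fst).
apply/subset_leq_card/subsetP => _ /imsetP[i iA ->].
move: iA; rewrite !inE negb_or /GI /= xy2 !eqxx !andbT.
by case/andP=> ix iy; rewrite [x.1 == i]eq_sym [y.1 == i]eq_sym ix iy.
Qed.

Lemma layer_cases x y : GI J x y -> ~~ spoke x y ->
  exists2 e, e = J`_x.1 \/ e = - J`_x.1 & y = (x.1, x.2 + e).
Proof.
rewrite /GI -/(spoke x y) => /orP[-> //|/andP[/eqP xy1 /orP[]/eqP xy2] _].
  by exists (J`_x.1); [left | rewrite -xy2 xy1 -surjective_pairing].
by exists (- J`_x.1); [right | rewrite -xy2 xy1 -surjective_pairing].
Qed.

(** A spoke from one end leaves the layer without changing the residue, so it cannot meet a
    neighbour of the other end; the third vertex closes a triangle inside the layer. *)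
Lemma layer_common x y z : GI J x y -> ~~ spoke x y ->
  z \in common_neighbours x y -> J`_x.1 *+ 3 = 0 /\ z = (x.1, x.2 - (y.2 - x.2)).
Proof.
move=> xy nxy; have [e eJ yE] := layer_cases xy nxy; rewrite {}yE {xy nxy}.
have e2 : e *+ 2 != 0 by case: eJ => ->; rewrite ?mulNrn ?oppr_eq0.
have e0 : e != 0 by apply: contraNneq e2 => ->; rewrite mul0rn.
rewrite inE => /andP[].
have pmE (r w : 'Z_n) : (r == w + J`_x.1) || (r == w - J`_x.1)
    = (r == w + e) || (r == w - e).
  by case: eJ => ->; rewrite ?opprK // orbC.
rewrite /GI /= !pmE; have [xz /=|] := eqVneq x.1 z.1; last first.
  move=> ? /orP[/eqP<-|//]; rewrite orbF => /eqP E; case/negP: e0.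
  by rewrite -[e](addKr x.2) E addrC subrr.
have add_eq (r w : 'Z_n) : (r == r + w) = (w == 0).
  by rewrite -{1}[r]addr0 (inj_eq (addrI _)) eq_sym.
case/orP=> /eqP zE; rewrite zE.
  by rewrite add_eq (negPf e0) addrK eq_sym add_eq (negPf e0).
rewrite addrK [X in _ || X]eq_sym add_eq oppr_eq0 (negPf e0) orbF.
rewrite -addrA (inj_eq (addrI _)) eq_sym => /eqP E.
have e3 : e *+ 3 = 0 by rewrite !mulrS addr0 E addrN.
split.
  by case: eJ e3 => -> //; rewrite mulNrn => /eqP; rewrite oppr_eq0 => /eqP.
by rewrite [z]surjective_pairing -xz zE [x.2 + e]addrC addrK.
Qed.

Lemma common_aut g x y : g \in graph_aut (GI J) ->
  #|common_neighbours (g x) (g y)| = #|common_neighbours x y|.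
Proof.
move/graph_autP=> ge; rewrite -[RHS](card_imset _ (@perm_inj _ g)).
apply: eq_card => z; rewrite -[z](permKV g) mem_imset; last exact: perm_inj.
by rewrite [LHS]inE [RHS]inE !ge.
Qed.

Lemma spoke_edge x y : spoke x y -> GI J x y.
Proof. by rewrite /GI /spoke => ->. Qed.

Lemma preserves_spokes k g : g \in graph_aut (GI J) ->
  (k.+2 < size J)%N ->
  (forall x y, GI J x y -> ~~ spoke x y -> #|common_neighbours x y| <= k)%N ->
  forall x y, spoke x y -> spoke (g x) (g y).
Proof.
move=> gG kJ layk x y xy; apply/negPn/negP => nsp.
have gxy : GI J (g x) (g y) by rewrite (graph_autP _ _ gG) spoke_edge.
have := layk _ _ gxy nsp; rewrite common_aut // leqNgt.
have := spoke_common xy; rewrite addn2 => /(leq_trans kJ).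
by rewrite !ltnS => ->.
Qed.


Lemma layer_common_le1 x y : GI J x y -> ~~ spoke x y ->
  (#|common_neighbours x y| <= 1)%N.
Proof.
move=> xy nxy; apply/card_le1_eqP => z w /(layer_common xy nxy)[_ ->].
by move/(layer_common xy nxy)=> [_ ->].
Qed.

Lemma layer_common_eq0 x y : J`_x.1 *+ 3 != 0 -> GI J x y -> ~~ spoke x y ->
  #|common_neighbours x y| = 0%N.
Proof.
move=> J3 xy nxy; apply: eq_card0 => z; apply/negP => /(layer_common xy nxy)[/eqP].
by rewrite (negPf J3).
Qed.

(** The delicate case is three layers, one of whose parameters is killed by 3. Then every edge at a
    vertex of that layer lies in a triangle, by transitivity every edge does, and 3 kills all
    parameters. *)
Lemma ge3_dichotomy : (2 < size J)%N -> vertex_transitive (GI J) ->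
  n = 3%N \/ forall g, g \in graph_aut (GI J) ->
  forall x y, spoke x y -> spoke (g x) (g y).
Proof.
move=> J3 tr; have [J4|J4] := ltnP 3 (size J).
  by right=> g gG; apply: (preserves_spokes gG J4) => x y; apply: layer_common_le1.
have [/forallP H|] := boolP [forall i : 'I_(size J), J`_i *+ 3 != 0].
  right=> g gG; apply: (preserves_spokes gG J3) => x y xy nxy.
  by rewrite layer_common_eq0.
rewrite negb_forall => /existsP[i /negPn/eqP i3]; left.
have edge i' : GI J (i', 0) (i', J`_i') by rewrite /GI /= !eqxx add0r eqxx.
have nspoke i' v : ~~ spoke (i', 0) (i', v) by rewrite /spoke eqxx.
pose o : T := (i, 0).
have i_tri y : GI J o y -> (0 < #|common_neighbours o y|)%N.
  move=> iy; have [sp|nsp] := boolP (spoke o y).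
    by have := leq_trans J3 (spoke_common sp); rewrite addn2.
  have [e eJ ->] := layer_cases iy nsp; apply/card_gt0P; exists (i, - e).
  have e3 : e *+ 3 = 0 by case: eJ => -> //; rewrite mulNrn i3 oppr0.
  have Ne : - e = e + e.
    by apply/eqP; rewrite eq_sym -addr_eq0 -addrA -[_ + _]/(e *+ 3) e3.
  rewrite inE /GI /= !eqxx /= add0r sub0r add0r.
  have JE : J`_i = e \/ J`_i = - e by case: eJ => ->; rewrite ?opprK; auto.
  by case: JE => ->; rewrite ?opprK -Ne !eqxx ?orbT.
apply/eqP; rewrite eqn_leq hn andbT; apply: dvdn_leq => //.
apply: spJ => j /(nthP 0)[k kJ <-].
have /(transitiveP _ o)/(_ o (Ordinal kJ, 0))[g gG gE] := tr.
have ge := graph_autP _ _ gG.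
have := i_tri (g^-1 (Ordinal kJ, J`_k))%g.
rewrite -ge gE permKV -(common_aut _ _ gG) gE permKV => /(_ (edge _)).
by case/card_gt0P=> z /(layer_common (edge _) (nspoke _ _))[].
Qed.

End CommonNeighbours.

(** Modulo 3 every parameter is 1 or -1, so [C] is trivial. *)
Lemma order3_cayley_params n (J : seq 'Z_n) : n = 3%N -> GI_params J ->
  cayley_params J.
Proof.
move=> n3; subst n => pJ; have [J0 _] := pJ.
exists 1%g, 1%G, (size J); split=> // r.
have -> : scale_params 1%g J = J.
  by rewrite /scale_params -[RHS]map_id; apply: eq_map => j; rewrite mul1r.
have mem1 (x : 'Z_3) : (x \in unit_vals (1%G : {group {unit 'Z_3}})) = (x == 1).
  apply/unit_valsP/eqP => [[c /set1P-> ->] //|->].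
  by exists 1%g; rewrite ?set11.
rewrite !mem1 /pm_mult.
have J1 j : j \in J -> j = 1 \/ j = - 1.
  move=> /(@params_double 3 isT J j pJ).
  by case: j => -[|[|[|k]]] // jn _; [left | right]; apply: val_inj.
have [->|r0] := eqVneq r 0.
  rewrite muln0; apply/eqP; rewrite -leqn0 leqNgt -has_count; apply/hasPn => j.
  by case/J1=> ->.
have {}J1 : all [pred j | (j == r) || (j == - r)] J.
  by apply/allP => j /J1[] ->; case: r r0 => -[|[|[|k]]].
move: J1; rewrite all_count => /eqP->.
by case: r r0 => -[|[|[|k]]] // rn _; rewrite muln1.
Qed.

(** * Closed reduced walks with two layers *)

Section WalkCount.
Variables (T : finType) (e : rel T).

(* [walks m x y x0 x1] counts the ways of prolonging a walk ending with the   *)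
(* arc [(x, y)] by [m] arcs, without backtracking, so as to close it at [x0]  *)
(* without backtracking along the first arc [(x0, x1)].                       *)
Fixpoint walks m x y x0 x1 : nat :=
  if m is m'.+1 then (\sum_(z | e y z && (z != x)) walks m' y z x0 x1)%N
  else (y == x0) && (x != x1).

Lemma walks_aut g m x y x0 x1 : g \in graph_aut e ->
  walks m (g x) (g y) (g x0) (g x1) = walks m x y x0 x1.
Proof.
move/graph_autP=> ge; elim: m x y => [|m IHm] x y /=.
  by rewrite !(inj_eq perm_inj).
rewrite (reindex_inj (@perm_inj _ g)) /=.
by apply: eq_big => z; rewrite ?ge ?(inj_eq perm_inj) // IHm.
Qed.

End WalkCount.

Definition dir_opp (d : option bool) := if d is Some b then Some (~~ b) else None.

(** The spoke, and the two directions along a layer. *)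
Definition dirs := [:: None; Some true; Some false].

Definition word_step (b : bool) (p : int * int) (d : option bool) :=
  if d is Some s then
    let e := if s then 1 else -1 in
    (b, if b then (p.1, p.2 + e) else (p.1 + e, p.2))
  else (~~ b, p).

(** Formal counterpart of [walks], independent of [n] and of the parameters: a word that returns to
    layer [b0] closes up according to its displacement, which is recorded with multiplicity. *)
Fixpoint words m b p d b0 d0 : seq (int * int) :=
  if m is m'.+1 then
    flatten [seq words m' (word_step b p d').1 (word_step b p d').2 d' b0 d0
            | d' <- dirs & d' != dir_opp d]
  else if (b == b0) && (dir_opp d != d0) then [:: p] else [::].

Lemma count_words (a : pred (int * int)) m b p d b0 d0 :
  count a (words m.+1 b p d b0 d0) =
  (\sum_(d' <- dirs | d' != dir_opp d)
     count a (words m (word_step b p d').1 (word_step b p d').2 d' b0 d0))%N.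
Proof.
rewrite [words _ _ _ _ _ _]/words -/words.
by rewrite count_flatten sumnE !big_map big_filter.
Qed.

Definition closed_words m b d :=
  words m.-1 (word_step b (0, 0) d).1 (word_step b (0, 0) d).2 d b d.

Section TwoLayers.
Variables (n : nat) (hn : (2 < n)%N) (j k : 'Z_n).
Let J := [:: j; k].
Hypotheses (pJ : GI_params J) (spJ : spans J).
Let T : finType := ('I_2 * 'Z_n)%type.
Implicit Types (x y z : T) (d : option bool) (b : bool).

Let e : rel T := @GI n J.

Definition layer b : 'I_2 := if b then ord_max else ord0.

Lemma layer_inj : injective layer.
Proof. by move=> [] []. Qed.

Definition neighbour x d : T :=
  if d is Some s then (x.1, if s then x.2 + J`_x.1 else x.2 - J`_x.1)
  else (rev_ord x.1, x.2).

Lemma neighbour_opp x d : neighbour (neighbour x d) (dir_opp d) = x.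
Proof.
by case: x d => i v [[]|]; rewrite /neighbour /= ?rev_ordK // ?addrK ?subrK.
Qed.

Lemma neighbour_inj x : injective (neighbour x).
Proof.
have J2 : J`_x.1 *+ 2 != 0.
  by apply: (params_double hn pJ); rewrite mem_nth.
have Jpm : x.2 + J`_x.1 != x.2 - J`_x.1.
  by rewrite (inj_eq (addrI _)) -subr_eq0 opprK -mulr2n.
have nrev : x.1 != rev_ord x.1 by case: x.1 => -[|[]].
by move=> [[]|] [[]|] //= /eqP; rewrite xpair_eqE ?eqxx //=
  ?[x.2 - _ == _]eq_sym ?(negPf Jpm) ?(negPf nrev) // eq_sym (negPf nrev).
Qed.

Lemma e_neighbour x y : e x y = (y \in [seq neighbour x d | d <- dirs]).
Proof.
rewrite /e /GI /= !inE [y]surjective_pairing !xpair_eqE /=.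
have -> : (x.1 != y.1) = (y.1 == rev_ord x.1).
  by case: x y => -[[|[|i]] ? v] [[[|[|l]] ? w]].
rewrite [x.2 == _]eq_sym [x.1 == _]eq_sym.
by case: (y.1 == x.1); rewrite /= ?orbF.
Qed.

Definition relator (p : int * int) := j *~ p.1 + k *~ p.2 == 0.

Definition position v b (p : int * int) : T := (layer b, v + (j *~ p.1 + k *~ p.2)).

Lemma neighbour_position v b p d :
  neighbour (position v b p) d = position v (word_step b p d).1 (word_step b p d).2.
Proof.
case: d => [s|]; last by case: b; congr (_, _); apply: val_inj.
rewrite /neighbour /position /word_step /=; case: b => /=; congr (_, _).
  by case: s; rewrite mulrzDr ?mulrN1z ?mulr1z !addrA.
by case: s; rewrite mulrzDr ?mulrN1z ?mulr1z -!addrA; congr (_ + (_ + _)); rewrite addrC.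
Qed.

(** The vertex before the current one is recovered by stepping back along [dir_opp d]. The three
    neighbours of a vertex are distinct, so walks correspond to words. *)
Lemma walks_words m v b p d b0 d0 :
  let x0 := position v b0 (0, 0) in
  walks e m (neighbour (position v b p) (dir_opp d)) (position v b p)
    x0 (neighbour x0 d0) =
  count relator (words m b p d b0 d0).
Proof.
move=> x0; elim: m b p d => [|m IHm] b p d.
  rewrite /= /x0 {1}/position xpair_eqE (inj_eq (addrI v)) mulr0z mulr0z addr0.
  rewrite (inj_eq layer_inj).
  case: eqVneq => //= <-; have [rel_p|nrel] := boolP (_ == 0); last first.
    by case: ifP => //= _; rewrite /relator (negPf nrel).
  have -> : position v b p = position v b (0, 0).
    by rewrite /position (eqP rel_p) /= !mulr0z !addr0.
  rewrite (inj_eq (@neighbour_inj _)); case: (_ != _) => //=.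
  by rewrite addn0 /relator (eqP rel_p) eqxx.
rewrite count_words /=; set y := position v b p.
transitivity (\sum_(z in [seq neighbour y d' | d' <- dirs & d' != dir_opp d])
    walks e m y z x0 (neighbour x0 d0))%N.
  apply: eq_bigl => z; rewrite e_neighbour; apply/andP/mapP =>
    [[/mapP[d' dd ->] zx]|].
    by exists d'; rewrite // mem_filter dd andbT; apply: contraNneq zx => ->.
  case=> d'; rewrite mem_filter => /andP[dd dirsd ->].
  by rewrite map_f // (inj_eq (@neighbour_inj _)).
rewrite -big_uniq; last by rewrite (map_inj_uniq (@neighbour_inj _)) filter_uniq.
rewrite big_map big_filter; apply: eq_bigr => d' _.
rewrite -IHm -neighbour_position -/y; congr walks.
by rewrite neighbour_opp.
Qed.

Definition closed_count m b d := count relator (closed_words m b d).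

Let position0 x : x = position x.2 (x.1 == ord_max) (0, 0).
Proof.
rewrite /position /= !mulr0z !addr0; case: x => -[[|[|i]] ?] v //=;
  congr (_, _); exact: val_inj.
Qed.

Lemma closed_countE m x d :
  walks e m.-1 x (neighbour x d) x (neighbour x d) = closed_count m (x.1 == ord_max) d.
Proof.
set b := _ == _; rewrite [x in LHS]position0 -/b; set v := x.2.
have := walks_words m.-1 v (word_step b (0, 0) d).1 (word_step b (0, 0) d).2 d b d.
by rewrite -neighbour_position neighbour_opp.
Qed.

Lemma closed_count_aut m g x d d' : g \in graph_aut e ->
  g (neighbour x d) = neighbour (g x) d' ->
  closed_count m (x.1 == ord_max) d = closed_count m ((g x).1 == ord_max) d'.
Proof. by move=> gG gd; rewrite -!closed_countE -gd walks_aut. Qed.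

Let relation_opp p : relator (- p.1, - p.2) = relator p.
Proof. by rewrite /relator !mulrNz -opprD oppr_eq0. Qed.

(** Opposite displacements are relators together, so one of each pair is kept. *)
Definition word_norm (p : int * int) : int * int :=
  if (p.1 < 0) || ((p.1 == 0) && (p.2 < 0)) then (- p.1, - p.2) else p.

Lemma count_norm s : count relator s = count relator (map word_norm s).
Proof.
rewrite count_map; apply: eq_count => p /=; rewrite /word_norm.
by case: ifP => // _; rewrite relation_opp.
Qed.

(** Reversing all layer steps of a word negates its displacement; the normalised lists are compared
    by computation. *)
Lemma closed_count_layer m b s : (m == 8) || (m == 10) ->
  closed_count m b (Some s) = closed_count m b (Some true).
Proof.
move=> m8; rewrite /closed_count count_norm [RHS]count_norm.
suff /seq.permP : perm_eq (map word_norm (closed_words m b (Some s)))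
    (map word_norm (closed_words m b (Some true))) by apply.
move: b s; case/orP: m8 => /eqP-> [] []; by vm_compute.
Qed.

Lemma edge_neighbour x y : e x y -> exists d, y = neighbour x d.
Proof. by rewrite e_neighbour => /mapP[d _ ->]; exists d. Qed.

Lemma neighbour_edge x d : e x (neighbour x d).
Proof. by rewrite e_neighbour map_f //; case: d => [[]|]. Qed.

Lemma aut_neighbour g x d : g \in graph_aut e ->
  exists d', g (neighbour x d) = neighbour (g x) d'.
Proof.
by move=> /graph_autP ge; apply: edge_neighbour; rewrite ge neighbour_edge.
Qed.

Lemma spoke_neighbour x y : spoke (J := J) x y -> y = neighbour x None.
Proof.
case/andP; case: x y => [[[|[|i]] ?] v] [[[|[|l]] ?] w] //= _ /eqP->;
  congr (_, _); exact: val_inj.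
Qed.

Lemma neighbour_spoke x : spoke (J := J) x (neighbour x None).
Proof. by rewrite /spoke eqxx andbT; case: x => -[[|[|i]] ?]. Qed.

(** An automorphism that exchanges layers at one vertex matches the three counts at its ends. Each
    side has one spoke count and a repeated layer count, so these agree separately. *)
Lemma layer_counts_eq m : (m == 8) || (m == 10) -> vertex_transitive e ->
  closed_count m false None = closed_count m true None /\
  closed_count m false (Some true) = closed_count m true (Some true).
Proof.
move=> m8 /(transitiveP _ (ord0, 0))/(_ (ord0, 0) (ord_max, 0))[g gG gx].
have cE d : exists2 d', g (neighbour (ord0, 0) d) = neighbour (ord_max, 0) d' &
    closed_count m false d = closed_count m true d'.
  have [d' gd] := aut_neighbour (ord0, 0) d gG; exists d'; first by rewrite -gx.
  by have := closed_count_aut m gG gd; rewrite gx.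
have [dS gS cS] := cE None.
have [dP gP cP] := cE (Some true); have [dM gM cM] := cE (Some false).
move: cM; rewrite closed_count_layer // => cM.
have PM : dP != dM.
  apply/eqP => E; rewrite E -gM in gP.
  by have := neighbour_inj (perm_inj gP).
have SP : dS != dP.
  apply/eqP => E; rewrite E -gP in gS.
  by have := neighbour_inj (perm_inj gS).
have SM : dS != dM.
  apply/eqP => E; rewrite E -gM in gS.
  by have := neighbour_inj (perm_inj gS).
have cT d : closed_count m true d =
    if d then closed_count m true (Some true) else closed_count m true None.
  by case: d => // s; rewrite closed_count_layer.
rewrite cT in cS; rewrite cT in cP; rewrite cT in cM.
move: cS cP cM PM SP SM {gS gP gM}.
by case: dS dP dM => [[]|] [[]|] [[]|] //=; split; congruence.
Qed.

Lemma not_preserving_counts g : vertex_transitive e -> g \in graph_aut e ->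
  ~ (forall x y, spoke (J := J) x y -> spoke (J := J) (g x) (g y)) ->
  forall m, (m == 8) || (m == 10) ->
  closed_count m false None = closed_count m false (Some true) /\
  closed_count m true (Some true) = closed_count m false (Some true).
Proof.
move=> tr gG nsp m m8; have [E1 E2] := layer_counts_eq m8 tr; split=> //.
have [|] := boolP [forall x, spoke (J := J) (g x) (g (neighbour x None))].
  by move/forallP=> H; case: nsp => x y /spoke_neighbour ->; apply: H.
rewrite negb_forall => /existsP[x nspx].
have [[s|] gd] := aut_neighbour x None gG; last by rewrite gd neighbour_spoke in nspx.
have := closed_count_aut m gG gd; rewrite closed_count_layer //.
by case: (x.1 == ord_max); case: ((g x).1 == ord_max) => E; congruence.
Qed.

(** By Cramer's rule the determinant kills both parameters, so [n] divides it. *)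
Lemma relation_det p q : relator p -> relator q ->
  p.1 * q.2 != p.2 * q.1 -> (n <= `|(p.1 * q.2 - p.2 * q.1)%R|)%N.
Proof.
move=> /eqP rp /eqP rq det0; apply: dvdn_leq; first by rewrite absz_gt0 subr_eq0.
apply: spJ => x xJ.
suff : x *~ (p.1 * q.2 - p.2 * q.1) = 0.
  case: (p.1 * q.2 - p.2 * q.1)%R => m.
    by rewrite -pmulrn absz_nat.
  by rewrite NegzE mulrNz abszN absz_nat -pmulrn => /eqP; rewrite oppr_eq0 => /eqP.
rewrite mulrzBr; move: xJ; rewrite !inE => /orP[]/eqP->.
  have rp' : (j *~ p.1 + k *~ p.2) *~ q.2 = 0 by rewrite rp mul0rz.
  have rq' : (j *~ q.1 + k *~ q.2) *~ p.2 = 0 by rewrite rq mul0rz.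
  move: rp' rq'; rewrite !mulrzDl -!mulrzA [q.2 * p.2]mulrC [q.1 * p.2]mulrC.
  move=> rp' rq'; apply/eqP; rewrite subr_eq0.
  by apply/eqP/(addIr (k *~ (p.2 * q.2))); rewrite rp' rq'.
have rp' : (j *~ p.1 + k *~ p.2) *~ q.1 = 0 by rewrite rp mul0rz.
have rq' : (j *~ q.1 + k *~ q.2) *~ p.1 = 0 by rewrite rq mul0rz.
move: rp' rq'; rewrite !mulrzDl -!mulrzA [q.1 * p.1]mulrC [q.2 * p.1]mulrC.
move=> rp' rq'; apply/eqP; rewrite subr_eq0.
by apply/eqP/(addrI (j *~ (p.1 * q.1))); rewrite rp' rq'.
Qed.

(* Any two of these are linearly independent, with determinant at most 26 in  *)
(* absolute value.                                                            *)
Definition short_relations : seq (int * int) :=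
  [:: (5, 1); (5, -1); (4, 2); (4, -2); (3, 3); (3, -3); (2, 4); (2, -4);
      (1, 5); (1, -5)].

Lemma small_order : closed_count 8 false None = closed_count 8 false (Some true) ->
  closed_count 8 true (Some true) = closed_count 8 false (Some true) ->
  (n <= 26)%N.
Proof.
rewrite /closed_count [count _ (closed_words _ false None)]count_norm.
rewrite [count _ (closed_words _ false (Some _))]count_norm.
rewrite [count _ (closed_words _ true _)]count_norm.
set l1 := map word_norm (closed_words 8 false None).
set l2 := map word_norm (closed_words 8 false (Some true)).
set l3 := map word_norm (closed_words 8 true (Some true)).
have r00 : relator (0, 0) by rewrite /relator /= !mulr0z addr0.
have J2 (r : 'Z_n) : r \in J -> r *+ 2 != 0.
  by move=> xJ; apply: (params_double hn pJ).
have r20 : relator (2, 0) = false.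
  rewrite /relator /= mulr0z addr0; apply: negbTE.
  by apply: (J2 j); rewrite !inE eqxx.
have r02 : relator (0, 2) = false.
  rewrite /relator /= mulr0z add0r; apply: negbTE.
  by apply: (J2 k); rewrite !inE eqxx orbT.
(* The closed words of length 8 have no spokes, with [(8, 0)] or [(0, 8)]; two spokes and runs of
   [a + b = 6] layer steps, giving a short relation; or four spokes and single steps, with entries 0
   or 2 up to sign. A short relation occurs twice from a spoke, and from a layer arc as often as its
   run in that layer is long. *)
have -> : count relator l1 = count relator (nseq 4 (0, 0) ++ nseq 4 (2, 0) ++
    nseq 4 (0, 2) ++ [:: (2, 2); (2, 2); (2, -2); (2, -2)] ++
    short_relations ++ short_relations).
  by apply/seq.permP; vm_compute.
have -> : count relator l2 = count relator (nseq 2 (0, 0) ++ nseq 2 (2, 0) ++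
    nseq 2 (0, 2) ++ [:: (2, 2); (2, -2); (8, 0)] ++ nseq 5 (5, 1) ++
    nseq 5 (5, -1) ++ nseq 4 (4, 2) ++ nseq 4 (4, -2) ++ nseq 3 (3, 3) ++
    nseq 3 (3, -3) ++ nseq 2 (2, 4) ++ nseq 2 (2, -4) ++ [:: (1, 5); (1, -5)]).
  by apply/seq.permP; vm_compute.
have -> : count relator l3 = count relator (nseq 2 (0, 0) ++ nseq 2 (2, 0) ++
    nseq 2 (0, 2) ++ [:: (2, 2); (2, -2); (0, 8)] ++ nseq 5 (1, 5) ++
    nseq 5 (1, -5) ++ nseq 4 (2, 4) ++ nseq 4 (2, -4) ++ nseq 3 (3, 3) ++
    nseq 3 (3, -3) ++ nseq 2 (4, 2) ++ nseq 2 (4, -2) ++ [:: (5, 1); (5, -1)]).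
  by apply/seq.permP; vm_compute.
rewrite !count_cat !count_nseq r00 r20 r02 !mul0n.
move=> E1 E2.
(* Let [A] count the relators among [(2, 2)] and [(2, -2)]. Without short relations, [2 + A] would
   be at most 1. A single one, of weights [w] and [6 - w] on the two layers, makes [4 + A] equal to
   [w] plus the indicator of [(8, 0)] and to [6 - w] plus that of [(0, 8)]; adding up, both
   indicators are 1. *)
have [c1|c1] := leqP 2 (count relator short_relations); last first.
  have [r80 r08] : relator (8, 0) /\ relator (0, 8).
    suff [H1 H2] : nat_of_bool (relator (8, 0)) = 1%N /\
        nat_of_bool (relator (0, 8)) = 1%N.
      by split; [rewrite -[relator _]lt0b H1 | rewrite -[relator _]lt0b H2].
    move: E1 E2 c1 (leq_b1 (relator (8, 0))) (leq_b1 (relator (0, 8))).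
    rewrite /short_relations /=.
    do ! [move: (nat_of_bool (relator _)) => ?].
    clear; lia.
  suff : (n <= 8)%N by move/leq_trans; apply.
  apply: dvdn_leq => //; apply: spJ => x; rewrite !inE => /orP[]/eqP->.
    by move: r80; rewrite /relator /= mulr0z addr0 => /eqP.
  by move: r08; rewrite /relator /= mulr0z add0r => /eqP.
have [p [q [pq ps qs rp rq]]] : exists p q,
    [/\ p != q, p \in short_relations, q \in short_relations, relator p
      & relator q].
  have : uniq (filter relator short_relations) by apply: filter_uniq.
  move: c1; rewrite -size_filter.
  have mem p := mem_filter relator p short_relations.
  case: (filter _ _) mem => [|p [|q s]] // mem _ /=.
  rewrite inE negb_or -andbA => /and3P[pq _ _].
  have /andP[rp ps] : relator p && (p \in short_relations).
    by rewrite -mem inE eqxx.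
  have /andP[rq qs] : relator q && (q \in short_relations).
    by rewrite -mem !inE eqxx orbT.
  by exists p, q.
have table : all (fun p => all (fun q => (p != q) ==>
    (p.1 * q.2 != p.2 * q.1) && (`|(p.1 * q.2 - p.2 * q.1)%R| <= 26)%N)
    short_relations) short_relations by vm_compute.
have /andP[det0 det26] := implyP (allP (allP table p ps) q qs) pq.
exact: leq_trans (relation_det rp rq det0) det26.
Qed.

End TwoLayers.

(** * Two layers: the finite search *)

(* The parameters [j] and [k] enter through the tables [X] and [Y] of their   *)
(* first multiples modulo [n]; only words normalised by [word_norm] are met.  *)
Definition table_relation (n : nat) (X Y : seq nat) (p : int * int) : bool :=
  match p with
  | (Posz a, Posz b) =>
      let s := (nth 0 X a + nth 0 Y b)%N in (s == 0)%N || (s == n)%N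
  | (Posz a, Negz b) => nth 0%N X a == nth 0%N Y b.+1
  | _ => false
  end.

Definition normal_words m b d := map word_norm (closed_words m b d).

Definition pm_eq_mod n a b := (a == b %[mod n])%N || (n %| a + b)%N.

Definition scaled_params_mod n j k a b :=
  has (fun u => coprime n u &&
    (pm_eq_mod n (u * j) a && pm_eq_mod n (u * k) b
     || pm_eq_mod n (u * j) b && pm_eq_mod n (u * k) a)) (iota 0 n).

(** The Petersen, dodecahedral and Desargues graphs, in this order. *)
Definition exceptional_mod n j k :=
  [|| (n == 5) && scaled_params_mod n j k 1 2,
      (n == 10) && scaled_params_mod n j k 1 2
    | (n == 10) && scaled_params_mod n j k 1 3]%N.

Definition square_params_mod n j k :=
  [&& coprime n j, coprime n k & j * j == k * k %[mod n]]%N.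

(** The orders run from 3 to 26, the bound of [small_order]. Multiples up to 10 suffice, as no word
    of length 10 has a larger displacement. *)
Definition small_cases :=
  let S8 := normal_words 8 false None in
  let O8 := normal_words 8 false (Some true) in
  let I8 := normal_words 8 true (Some true) in
  let S10 := normal_words 10 false None in
  let O10 := normal_words 10 false (Some true) in
  all (fun n =>
    let table := [seq [seq (a * j %% n)%N | a <- iota 0 11] | j <- iota 0 n] in
    all (fun j => all (fun k =>
      let r := table_relation n (nth [::] table j) (nth [::] table k) in
      [&& j.*2 != n, k.*2 != n, gcdn (gcdn n j) k == 1, count r S8 == count r O8,
          count r I8 == count r O8 & count r S10 == count r O10]%N ==>
      square_params_mod n j k || exceptional_mod n j k)
      (iota 1 n.-1)) (iota 1 n.-1)) (iota 3 24).

Lemma small_casesT : small_cases.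
Proof. by lazy. Qed.

Section SmallOrders.
Variables (n : nat) (hn : (2 < n)%N) (j k : 'Z_n).
Let J := [:: j; k].
Hypotheses (pJ : GI_params J) (spJ : spans J).
Let n1 : (1 < n)%N := ltnW hn.

Let table (r : nat) := [seq (a * r %% n)%N | a <- iota 0 11].

Let table_nth r a : (a <= 10)%N -> nth 0%N (table r) a = (a * r %% n)%N.
Proof. by move=> a10; rewrite (nth_map 0%N) ?size_iota // nth_iota. Qed.

Let ltZ (r : 'Z_n) : (r < n)%N.
Proof. by have := ltn_ord r; rewrite [X in (_ < X)%N]Zp_cast. Qed.

Let natZ (a : nat) (r : 'Z_n) : r *+ a = (a * r)%:R.
Proof. by rewrite -[r in LHS]natr_Zp -mulrnA mulnC. Qed.

Definition small_word (p : int * int) :=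
  match p with
  | (Posz a, Posz b) => (a <= 10)%N && (b <= 10)%N
  | (Posz a, Negz b) => (a <= 10)%N && (b < 10)%N
  | _ => false
  end.

Lemma table_relationE p : small_word p ->
  relator j k p = table_relation n (table j) (table k) p.
Proof.
have n0 : (0 < n)%N by apply: ltn_trans n1.
case: p => [[a|a] [b|b]] // /andP[a10 b10];
  rewrite [RHS]/table_relation !table_nth //.
  rewrite /relator /= -!pmulrn (natZ a j) (natZ b k) -natrD.
  rewrite (Zn_natr_eq0 hn) /dvdn -modnDm.
  have := ltn_pmod (a * j) n0; have := ltn_pmod (b * k) n0.
  move: (a * j %% n)%N (b * k %% n)%N => s t tn sn.
  apply/eqP/orP => [E|[/eqP->|/eqP->]]; rewrite ?mod0n ?modnn //.
  have [st|st] := ltnP (s + t) n; first by left; rewrite -E modn_small.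
  right; move: E; rewrite -(subnK st) modnDr modn_small; lia.
rewrite /relator /= NegzE mulrNz -!pmulrn (natZ a j) (natZ b.+1 k) subr_eq0.
rewrite -val_eqE /=.
by rewrite !val_Zp_nat.
Qed.

Lemma closed_count_table m b d : all small_word (normal_words m b d) ->
  closed_count j k m b d =
  count (table_relation n (table j) (table k)) (normal_words m b d).
Proof.
move=> small; rewrite /closed_count count_norm; apply: eq_in_count => p pw.
by rewrite table_relationE // (allP small).
Qed.

Lemma param_bounds (r : 'Z_n) :
  r \in J -> (val r \in iota 1 n.-1) /\ (val r).*2 != n.
Proof.
case: pJ => _ H /H[r0 r2]; split; last exact/eqP.
by rewrite mem_iota r0 add1n prednK ?ltZ // (ltn_trans _ n1).
Qed.

Lemma coprime_params : gcdn (gcdn n j) k == 1%N.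
Proof.
set d := gcdn _ _.
have n0 : (0 < n)%N by apply: ltn_trans n1.
have dn : (d %| n)%N by rewrite (dvdn_trans (dvdn_gcdl _ _)) ?dvdn_gcdl.
have d0 : (0 < d)%N by exact: dvdn_gt0 dn.
have d_le : (d <= n)%N by apply: dvdn_leq dn.
have /dvdn_leq : (n %| n %/ d)%N.
  have H (r : 'Z_n) : (d %| r)%N -> r *+ (n %/ d) = 0.
    move=> dr; apply/eqP; rewrite (Zn_mulrn_eq0 hn) muln_divA //.
    by rewrite mulnC -muln_divA ?dvdn_mulr.
  apply: spJ => r; rewrite !inE => /orP[]/eqP->; apply: H.
    by rewrite (dvdn_trans (dvdn_gcdl _ _)) ?dvdn_gcdr.
  by rewrite dvdn_gcdr.
rewrite divn_gt0 // d_le => /(_ isT) H.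
rewrite eqn_leq d0 andbT leqNgt; apply/negP => d1.
by move: H; rewrite leqNgt ltn_Pdiv.
Qed.

Lemma small_counts_params : (n <= 26)%N ->
  (forall m, (m == 8) || (m == 10) ->
    closed_count j k m false None = closed_count j k m false (Some true) /\
    closed_count j k m true (Some true) = closed_count j k m false (Some true)) ->
  square_params_mod n j k || exceptional_mod n j k.
Proof.
move=> n26 cjk.
have [jI j2] := param_bounds (mem_head _ _ : j \in J).
have kJ : k \in J by rewrite !inE eqxx orbT.
have [kI k2] := param_bounds kJ.
have tE (r : 'Z_n) :
    nth [::] [seq [seq (a * j %% n)%N | a <- iota 0 11] | j <- iota 0 n] r = table r.
  by rewrite (nth_map 0%N) ?size_iota ?nth_iota ?ltZ.
have small m b d : (m == 8) || (m == 10) -> all small_word (normal_words m b d).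
  by case/orP=> /eqP->; case: b d => [] [[]|]; vm_compute.
have n27 : (2 < n < 3 + 24)%N by lia.
have := small_casesT; rewrite /small_cases => /allP/(_ n).
rewrite mem_iota => /(_ n27).
move/allP/(_ _ jI)/allP/(_ _ kI)/implyP; apply.
rewrite !tE j2 k2 !andTb coprime_params andTb.
have tblE m b d m8 := closed_count_table (small m b d m8).
have countE m b d b' d' : (m == 8) || (m == 10) ->
    closed_count j k m b d = closed_count j k m b' d' ->
    count (table_relation n (table j) (table k)) (normal_words m b d)
    == count (table_relation n (table j) (table k)) (normal_words m b' d').
  by move=> m8 E; rewrite -!tblE // E.
have [S8 I8] := cjk 8 isT; have [S10 _] := cjk 10 isT.
by apply/and3P; split; [exact: countE S8 | exact: countE I8 | exact: countE S10].
Qed.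

End SmallOrders.

(** * The pairs of parameters that survive the search *)

Section TwoParameters.
Variables (n : nat) (hn : (2 < n)%N) (j k : 'Z_n).
Let n1 : (1 < n)%N := ltnW hn.

Let pm_eqP (u : nat) (r : 'Z_n) (a : nat) : pm_eq_mod n (u * r) a ->
  u%:R * r = a%:R \/ u%:R * r = - a%:R.
Proof.
have -> : u%:R * r = (u * r)%:R by rewrite natrM natr_Zp.
case/orP=> [/eqP E|ua]; [left | right].
  by apply: val_inj; rewrite /= !val_Zp_nat.
by apply/eqP; rewrite -addr_eq0 -natrD (Zn_natr_eq0 hn).
Qed.

Lemma scaled_params_modP a b : scaled_params_mod n j k a b ->
  exists u : {unit 'Z_n},
    pm_mult (scale_params u [:: j; k]) =1 pm_mult [:: a%:R; b%:R].
Proof.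
case/hasP=> u _ /andP[nu H].
have uu : (u%:R : 'Z_n) \is a GRing.unit by rewrite unitZpE.
exists (FinRing.unit 'Z_n uu) => x; rewrite /pm_mult /= !addn0.
have E (y z : 'Z_n) : y = z \/ y = - z ->
    ((y == x) || (y == - x)) = ((z == x) || (z == - x)).
  by case=> -> //; rewrite eqr_opp eqr_oppLR orbC.
case/orP: H => /andP[/pm_eqP/E -> /pm_eqP/E ->] //.
by rewrite addnC.
Qed.

Lemma scaled_params_iso a b : scaled_params_mod n j k a b ->
  graph_iso (GI [:: j; k]) (GI [:: a%:R; b%:R : 'Z_n]).
Proof.
case/scaled_params_modP=> u H.
apply: graph_iso_trans (GI_scale_iso u _) _; exact: pm_mult_iso.
Qed.

(** The quotient [r = k / j] squares to 1: [C] consists of 1 and [r], or is trivial with [m = 2] if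
    [r] is 1 or -1. *)
Lemma square_cayley_params : square_params_mod n j k -> cayley_params [:: j; k].
Proof.
case/and3P=> nj nk /eqP jk.
have uj : j \is a GRing.unit by rewrite -[j]natr_Zp unitZpE.
have uk : k \is a GRing.unit by rewrite -[k]natr_Zp unitZpE.
have jjkk : j * j = k * k.
  apply: val_inj; rewrite /= [X in (_ %% X)%N = _]Zp_cast //.
  by rewrite [X in _ = (_ %% X)%N]Zp_cast.
pose u : {unit 'Z_n} := ((FinRing.unit 'Z_n uj)^-1)%g.
pose r : {unit 'Z_n} := (u * FinRing.unit 'Z_n uk)%g.
have rr : val r * val r = 1.
  by rewrite /= mulrACA -jjkk mulrACA mulVr // mulr1.
have Ju : scale_params u [:: j; k] = [:: 1; val r] by rewrite /scale_params /= mulVr.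
have mJ x : pm_mult [:: 1; val r] x =
    (((x == 1) || (- x == 1))%R + ((x == val r) || (- x == val r))%R)%N.
  rewrite /pm_mult /= addn0 [1 == x]eq_sym [1 == - x]eq_sym.
  by rewrite [val r == x]eq_sym [val r == - x]eq_sym.
have C1 x : (x \in unit_vals (1%G : {group {unit 'Z_n}})) = (x == 1).
  apply/unit_valsP/eqP => [[c /set1P-> ->] //|->].
  by exists 1%g; rewrite ?set11.
have one_ne (x : 'Z_n) : (x == 1) && (- x == 1) = false.
  by apply/andP => -[/eqP-> /eqP E]; case/negP: (one_neqN1 hn); apply/eqP/esym.
have [r1|r1] := boolP ((val r == 1) || (val r == - 1)).
  exists u, 1%G, 2%N; split=> // x; rewrite Ju mJ !C1.
  have -> : ((x == val r) || (- x == val r)) = ((x == 1) || (- x == 1)).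
    by case/orP: r1 => /eqP-> //; rewrite eqr_opp [- x == 1]eqr_oppLR orbC.
  by move: (one_ne x); case: (x == 1); case: (- x == 1).
have gC : group_set [set 1%g; r].
  apply/group_setP; split=> [|a b]; first by rewrite !inE eqxx.
  rewrite !inE => /orP[]/eqP-> /orP[]/eqP->; rewrite ?mulg1 ?mul1g ?eqxx ?orbT //.
  by rewrite (_ : (r * r = 1)%g) ?eqxx //; apply: val_inj.
exists u, (Group gC), 1%N; split=> // x; rewrite Ju mJ mul1n.
have CE y : (y \in unit_vals (Group gC)) = (y == 1) || (y == val r).
  apply/unit_valsP/orP => [[c /set2P[]-> ->]|[/eqP->|/eqP->]].
  - by left.
  - by right.
  - by exists 1%g; rewrite ?set21.
  - by exists r; rewrite ?set22.
rewrite !CE.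
have r_ne : (x == val r) && (- x == val r) = false.
  apply/andP => -[/eqP-> /eqP E]; case/negP: (unit_double hn (valP r)).
  by rewrite mulr2n -{1}E addNr.
have [r_neq1 r_neqN1] : (val r == 1) = false /\ (val r == - 1) = false.
  by move: r1; case: (val r == 1); case: (_ == _).
have F1 : (x == 1) && (x == val r) = false.
  by apply/andP => -[/eqP-> /eqP E]; rewrite -E eqxx in r_neq1.
have F2 : (- x == 1) && (- x == val r) = false.
  by apply/andP => -[/eqP-> /eqP E]; rewrite -E eqxx in r_neq1.
have F3 : (x == 1) && (- x == val r) = false.
  by apply/andP => -[/eqP-> /eqP E]; rewrite -E eqxx in r_neqN1.
have F4 : (- x == 1) && (x == val r) = false.
  by apply/andP => -[/eqP E /eqP E']; rewrite -E' -E opprK eqxx in r_neqN1.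
move: (one_ne x) r_ne F1 F2 F3 F4.
by case: (x == 1); case: (- x == 1); case: (x == val r); case: (- x == val r).
Qed.

End TwoParameters.

Lemma transitive_params_mult n (J K : seq 'Z_n) (u : {unit 'Z_n}) :
  pm_mult (scale_params u J) =1 pm_mult K ->
  (forall x, pm_mult K x = (x \is a GRing.unit)) -> (2 < n)%N -> transitive_params J.
Proof.
move=> JK KU hn.
have unitsT x : (x \in unit_vals [set: {unit 'Z_n}]%G) = (x \is a GRing.unit).
  apply/unit_valsP/idP => [[c _ ->]|ux]; first exact: valP.
  by exists (FinRing.unit 'Z_n ux); rewrite ?inE.
exists u, [set: {unit 'Z_n}]%G, 1%N; split=> // [|x].
  by rewrite unitsT unitrN1.
by rewrite JK KU mul1n unitsT.
Qed.

Lemma units5 (x : 'Z_5) : pm_mult [:: 1%:R; 2%:R] x = (x \is a GRing.unit).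
Proof. by case: x => -[|[|[|[|[|x]]]]]. Qed.

Lemma units10 (x : 'Z_10) : pm_mult [:: 1%:R; 3%:R] x = (x \is a GRing.unit).
Proof. by case: x => -[|[|[|[|[|[|[|[|[|[|x]]]]]]]]]]. Qed.

(** * The three exceptional graphs are not Cayley *)

Section WalkPositivity.
Variables (T : finType) (e : rel T).

Lemma walksS_gt0 m x y x0 x1 :
  reflect (exists z, [/\ e y z, z != x & 0 < walks e m y z x0 x1]%N)
          (0 < walks e m.+1 x y x0 x1)%N.
Proof.
rewrite lt0n /= sum_nat_eq0 negb_forall; apply: (iffP existsP) => -[z].
  by rewrite negb_imply -lt0n => /andP[/andP[yz zx] H]; exists z.
by case=> yz zx H; exists z; rewrite negb_imply yz zx -lt0n.
Qed.

Lemma walks0_gt0 x y x0 x1 :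
  (0 < walks e 0 x y x0 x1)%N = (y == x0) && (x != x1).
Proof. by rewrite /= lt0b. Qed.

End WalkPositivity.

Section GirthFive.
Variables (n : nat) (hn : (2 < n)%N) (j k : 'Z_n).
Hypothesis pJ : GI_params [:: j; k].
Let T : finType := ('I_2 * 'Z_n)%type.
Let e : rel T := @GI n [:: j; k].

(** Turns the hypotheses of [cayley_girth5] into counts of closed words, which can be computed. *)
Lemma girth5_not_cayley :
  (forall b d, closed_count j k 3 b d = 0%N) ->
  (forall b d, closed_count j k 4 b d = 0%N) ->
  (forall b d, 0 < closed_count j k 5 b d)%N -> ~ is_cayley e.
Proof.
move=> c3 c4 c5 /(cayley_elim (ord0, 0))[G Gact].
have e_sym : symmetric e by exact: (@GI_sym n [:: j; k]).
have e_irr : irreflexive e by exact: (@GI_irr n [:: j; k]).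
have ne x y : e x y -> x != y by apply: contraTneq => ->; rewrite e_irr.
have count0 m x y : (forall b d, closed_count j k m b d = 0%N) -> e x y ->
    walks e m.-1 x y x y = 0%N.
  by move=> cm /edge_neighbour[d ->]; rewrite closed_countE // cm.
apply: (cayley_girth5 (x0 := (ord0, 0)) e_sym Gact); rewrite ?e_irr //.
- rewrite -[3%N]/(size [seq neighbour j k (ord0, 0) d | d <- dirs]).
  rewrite -(card_uniqP _); last by rewrite (map_inj_uniq (@neighbour_inj _ hn _ _ pJ _)).
  by apply: eq_card => y; rewrite -e_neighbour inE.
- move=> x y z xy yz; apply/negP; rewrite e_sym => zx.
  suff : (0 < walks e 2 x y x y)%N by rewrite (count0 3).
  apply/walksS_gt0; exists z; rewrite yz ne //; split=> //.
  apply/walksS_gt0; exists x; rewrite zx ne //; split=> //.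
  by rewrite walks0_gt0 eqxx eq_sym ne.
- move=> x y z w xy yz zw wx.
  have [->|xz] := eqVneq x z; first by left.
  have [->|yw] := eqVneq y w; first by right.
  suff : (0 < walks e 3 x y x y)%N by rewrite (count0 4).
  apply/walksS_gt0; exists z; rewrite yz eq_sym; split=> //.
  apply/walksS_gt0; exists w; rewrite zw eq_sym; split=> //.
  apply/walksS_gt0; exists x; rewrite wx; split=> //.
  by rewrite walks0_gt0 eqxx eq_sym.
- move=> x y xy.
  have : (0 < walks e 4 x y x y)%N.
    by have [d ->] := edge_neighbour xy; rewrite (closed_countE hn pJ 5) c5.
  case/walksS_gt0=> z [yz _ /walksS_gt0[w [zw _ /walksS_gt0[u [wu _]]]]].
  case/walksS_gt0=> v [uv _]; rewrite walks0_gt0 => /andP[/eqP vx _].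
  by exists z, w, u; rewrite -vx.
Qed.

End GirthFive.

Lemma petersen_not_cayley : ~ is_cayley (@GI 5 [:: 1%:R; 2%:R]).
Proof.
apply: girth5_not_cayley => [||b d|b d|b d] //.
- by split=> // j; rewrite !inE => /orP[]/eqP->.
- by case: b d => [] [[]|]; vm_compute.
- by case: b d => [] [[]|]; vm_compute.
- by case: b d => [] [[]|]; vm_compute.
Qed.

Lemma dodecahedral_not_cayley : ~ is_cayley (@GI 10 [:: 1%:R; 2%:R]).
Proof.
apply: girth5_not_cayley => [||b d|b d|b d] //.
- by split=> // j; rewrite !inE => /orP[]/eqP->.
- by case: b d => [] [[]|]; vm_compute.
- by case: b d => [] [[]|]; vm_compute.
- by case: b d => [] [[]|]; vm_compute.
Qed.

(* Two vertices of the Desargues graph at distance 4 are adjacent in one of   *)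
(* two disjoint Petersen graphs; [twist] turns this relation into GI(10;4,2). *)
Definition twist (x : 'I_2 * 'Z_10) : 'I_2 * 'Z_10 :=
  (x.1, if x.1 == ord0 then x.2 else x.2 + 5%:R).

Definition distance4 (x y : 'I_2 * 'Z_10) := @GI 10 [:: 4%:R; 2%:R] (twist x) (twist y).

Definition desargues := @GI 10 [:: 1%:R; 3%:R].

Definition desargues2 (x : 'I_2 * 'Z_10) : seq ('I_2 * 'Z_10) :=
  flatten [seq [seq neighbour 1%:R 3%:R y d | d <- dirs]
          | y <- [seq neighbour 1%:R 3%:R x d | d <- dirs]].

Definition vertices : seq ('I_2 * 'Z_10) :=
  [seq (inZp i, inZp v) | i <- iota 0 2, v <- iota 0 10].

Lemma mem_vertices x : x \in vertices.
Proof.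
case: x => i v; apply/allpairsP; exists (val i, val v).
by split; rewrite ?mem_iota ?ltn_ord //= !valZpK.
Qed.

Lemma distance4E x y : distance4 x y =
  (y \notin desargues2 x) && has (fun z => y \in desargues2 z) (desargues2 x).
Proof.
have := mem_vertices y; have := mem_vertices x; move: x y.
suff : all (fun x => all (fun y => distance4 x y ==
  (y \notin desargues2 x) && has (fun z => y \in desargues2 z) (desargues2 x))
  vertices) vertices.
  by move=> /allP H x y /H/allP Hx /Hx/eqP.
by vm_compute.
Qed.

(** The Desargues graph is bipartite, so [cayley_girth5] does not apply to it directly. A regular
    group of its automorphisms also preserves [distance4], to which the criterion does apply. *)
Lemma desargues_not_cayley : ~ is_cayley desargues.
Proof.
case/(cayley_elim (ord0, 0)) => G [Ge Gtr Gfree].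
have mem2 x y : (y \in desargues2 x) = [exists z, desargues x z && desargues z y].
  rewrite /desargues2; apply/flatten_mapP/existsP => [[z xz zy]|[z /andP[xz zy]]].
    by exists z; rewrite /desargues !e_neighbour xz.
  by exists z; rewrite -e_neighbour.
have mem2_aut g x y : g \in G -> (g y \in desargues2 (g x)) = (y \in desargues2 x).
  move=> gG; rewrite !mem2; apply/existsP/existsP => -[z].
    by rewrite -[z](permKV g) !Ge // => H; exists ((g^-1)%g z).
  by move=> H; exists (g z); rewrite !Ge.
have d4 : is_cayley distance4.
  apply: (@cayley_intro _ _ G (ord0, 0)) => //; first by move=> g h; apply: groupM.
  split=> // g gG x y; rewrite !distance4E mem2_aut //; congr (_ && _).
  apply/hasP/hasP => -[z xz zy].
    exists ((g^-1)%g z); first by rewrite -(mem2_aut g) ?permKV.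
    by rewrite -(mem2_aut g) ?permKV.
  by exists (g z); rewrite mem2_aut.
have : is_cayley (@GI 10 [:: 4%:R; 2%:R]).
  apply: graph_iso_cayley (ord0, 0) _ d4; exists twist => //.
  exists (fun x => (x.1, if x.1 == ord0 then x.2 else x.2 - 5%:R)) => -[i v];
    by rewrite /twist /=; case: (i == ord0); rewrite /= ?addrK ?subrK.
apply: girth5_not_cayley => [||b d|b d|b d] //.
- by split=> // j; rewrite !inE => /orP[]/eqP->.
- by case: b d => [] [[]|]; vm_compute.
- by case: b d => [] [[]|]; vm_compute.
- by case: b d => [] [[]|]; vm_compute.
Qed.

(** * Assembly of the two directions *)

Lemma cayley_vertex_transitive (T : finType) (e : rel T) (x0 : T) :
  is_cayley e -> vertex_transitive e.
Proof.
case/(cayley_elim x0)=> G [Ge Gtr _]; apply/(transitiveP _ x0) => x y.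
have [g gG gxy] := Gtr x y; exists g => //; apply/graph_autP; exact: Ge.
Qed.

Definition preserving_spokes n (J : seq 'Z_n) :=
  forall g, g \in graph_aut (GI J) ->
  forall x y, spoke (J := J) x y -> spoke (J := J) (g x) (g y).

Lemma vertex_transitive_cases n (J : seq 'Z_n) : (2 < n)%N -> GI_params J ->
  spans J -> vertex_transitive (GI J) ->
  [\/ preserving_spokes J, cayley_params J |
      exists j k, J = [:: j; k] /\ exceptional_mod n j k].
Proof.
move=> hn pJ spJ tr; have [J3|J3] := ltnP 2 (size J).
  have [n3|] := ge3_dichotomy hn pJ spJ J3 tr; last by constructor 1.
  by constructor 2; apply: order3_cayley_params.
case EJ : {1 2}J (proj1 pJ) J3 => [//|j [|k [|? ?]]] // _ _.
  (* A single layer has no spokes. *)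
  constructor 1 => g _ x y /andP[xy _]; case/negP: xy; apply/eqP/val_inj.
  by rewrite EJ in x y *; case: x y => [[[|?] ?] ?] [[[|?] ?] ?].
have [/forall_inP H|] := boolP [forall g in graph_aut (GI J), forall x, forall y,
    spoke x y ==> spoke (g x) (g y)].
  by constructor 1 => g gG x y; apply/implyP; have /forallP/(_ x)/forallP := H g gG.
rewrite negb_forall_in => /exists_inP[g gG nsp].
subst J; have {}nsp : ~ forall x y, spoke (J := [:: j; k]) x y ->
    spoke (J := [:: j; k]) (g x) (g y).
  move=> H; case/negP: nsp; apply/forallP => x; apply/forallP => y.
  by apply/implyP; apply: H.
have counts := not_preserving_counts hn pJ tr gG nsp.
have [E F] := counts 8 isT.
have n26 := small_order hn pJ spJ E F.
have /orP[sq|ex] := small_counts_params hn pJ spJ n26 counts.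
  by constructor 2; apply: square_cayley_params.
by constructor 3; exists j, k.
Qed.

Lemma vertex_transitive_params n (J : seq 'Z_n) : (2 < n)%N -> GI_params J ->
  spans J -> vertex_transitive (GI J) -> ~ graph_iso (GI J) dodecahedral_graph ->
  transitive_params J.
Proof.
move=> hn pJ spJ tr ndod.
have x0 := (Ordinal (proj1 pJ), 0 : 'Z_n).
case: (vertex_transitive_cases hn pJ spJ tr) => [pres|cp|[j [k [EJ ex]]]].
- apply: (respecting_transitive_params hn pJ spJ (G := graph_aut_group (GI J))) pres.
    by move=> g /graph_autP.
  exact/(transitiveP _ x0).
- exact: cayley_transitive_params.
subst J; case/or3P: ex => /andP[/eqP n5 ex]; subst n.
- have [u H] := scaled_params_modP hn ex.
  exact: transitive_params_mult H units5 hn.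
- by case: ndod; exact: (scaled_params_iso hn ex).
have [u H] := scaled_params_modP hn ex.
exact: transitive_params_mult H units10 hn.
Qed.

Lemma cayley_params_of_cayley n (J : seq 'Z_n) : (2 < n)%N -> GI_params J ->
  spans J -> is_cayley (GI J) -> cayley_params J.
Proof.
move=> hn pJ spJ cay.
have x0 := (Ordinal (proj1 pJ), 0 : 'Z_n).
have tr := cayley_vertex_transitive x0 cay.
case: (vertex_transitive_cases hn pJ spJ tr) => [pres|//|[j [k [EJ ex]]]].
  have [G [Ge Gtr Gfree]] := cayley_elim x0 cay.
  apply: (respecting_cayley_params hn pJ spJ Ge Gtr _ Gfree) => g gG.
  by apply: pres; apply/graph_autP; apply: Ge.
subst J; case/or3P: ex => /andP[/eqP n5 ex]; subst n;
  have := graph_iso_cayley x0 (scaled_params_iso hn ex) cay.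
- by move/petersen_not_cayley.
- by move/dodecahedral_not_cayley.
by move/desargues_not_cayley.
Qed.

(** By cardinality [A] is the union of [B] and [- B], and primitivity bounds each multiplicity by
    1. *)
Lemma primitive_subgroup_params n (J : seq 'Z_n) (u : {unit 'Z_n}) : (2 < n)%N ->
  primitive_subgroup (scale_params u J) -> cayley_params J.
Proof.
move=> hn [[_ prK] [A [KA [B [BA iAB BN1]]]]].
set K := scale_params u J in prK KA *.
exists u, B, 1%N; split=> // x; rewrite -/K mul1n.
have [A' [_ cA' A'E]] := pm_group B.
have AA' : A' = A :> {set _}.
  apply/eqP; rewrite eqEcard cA' // -(LagrangeI A B) (setIidPr BA) iAB leqnn andbT.
  apply/subsetP => a; rewrite -(mem_unit_vals A') A'E -(mem_unit_vals A) -KA mem_pm_set.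
  have BK (z : 'Z_n) : z \in unit_vals B -> (0 < pm_mult K z)%N.
    case/unit_valsP=> b bB ->; rewrite -mem_pm_set KA mem_unit_vals.
    exact: (subsetP BA).
  by case/orP=> /BK //; rewrite pm_mult_opp.
have K1 : (pm_mult K x <= 1)%N.
  rewrite pm_mult_card; apply/card_le1_eqP => i k; rewrite !inE => Ki Kk.
  apply/eqP; apply: contraT => ik; have [] := prK _ _ ik.
  by case/orP: Ki Kk => /eqP-> /orP[]/eqP->; rewrite ?opprK.
have := unit_vals_le1 x BN1.
have : (0 < pm_mult K x)%N = (0 < (x \in unit_vals B) + (- x \in unit_vals B))%N.
  by rewrite -mem_pm_set KA -AA' A'E addn_gt0 !lt0b.
by move: K1; do 2 case: (_ \in _); case: pm_mult => [|[]].
Qed.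

Theorem theorem24 (n : nat) (hn : (2 < n)%N) (J : seq 'Z_n)
    (hJ : GI_params J) (hconn : graph_connected (GI J)) :
  is_cayley (GI J) <->
  (exists u : {unit 'Z_n}, primitive_subgroup (scale_params u J))
  \/
  (exists (J0 : seq 'Z_n) (k0 : nat),
     [/\ GI_params J0, primitive J0, (1 < k0)%N,
         graph_iso (GI J) (GI (repeat_params k0 J0)) &
         is_cayley (GI J0)
         \/ [/\ ~~ odd k0, vertex_transitive (GI J0) &
                ~ graph_iso (GI J0) dodecahedral_graph]]).
Proof.
have spJ := connected_spans hn hJ hconn.
split=> [cay|[[u sub]|[J0 [k0 [pJ0 [J1 _] k1 iso alt]]]]].
- by apply: cayley_params_alternatives => //; apply: cayley_params_of_cayley.
- apply: cayley_params_cayley => //; first exact: (proj1 hJ).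
  exact: primitive_subgroup_params hn sub.
have k_gt0 : (0 < k0)%N by apply: ltnW.
have spJ0 := spans1 hn J1.
have cp : cayley_params (repeat_params k0 J0).
  case: alt => [cay|[k2 tr ndod]].
    by apply: repeat_cayley_params => //; apply: cayley_params_of_cayley.
  by apply: repeat_transitive_params => //; apply: vertex_transitive_params.
have [f [f' _ _] _] := iso.
have K0 : (0 < size (repeat_params k0 J0))%N.
  exact: leq_ltn_trans (ltn_ord (f (Ordinal (proj1 hJ), 0)).1).
apply: (graph_iso_cayley (Ordinal K0, 0) (graph_iso_sym iso)).
exact: cayley_params_cayley.
Qed.
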